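(* Let $\varepsilon>0$ be a constant. For $p=p(n)\ge n^{-2/3+\varepsilon}$, a random graph $G\sim G_{n,p}$ asymptotically almost surely (i.e. with probability tending to $1$ as $n\to\infty$) has the following property: playing a $(2:2)$ Connector-Breaker game on the edge set of $G$, Connector has a strategy to claim all edges of a spanning tree of $G$.
   Context: $G_{n,p}$ is the binomial random graph on $n$ vertices in which each edge is present independently with probability $p$ (so $p\le 1$). In the $(2:2)$ Connector-Breaker game on a graph $G$, the two players alternately take turns, Connector moving first; in each turn a player claims up to two previously unclaimed edges of $G$, with the restriction that Connector must choose her edges so that the graph formed by her claimed edges is connected throughout the game. *)

(* Defs.v *)
From mathcomp Require Import all_boot all_order all_algebra.
From mathcomp Require Import boolp reals.

Set Implicit Arguments.
Unset Strict Implicit.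
Unset Printing Implicit Defensive.

Section Graphs.
Variable V : finType.

(* A simple graph on V is given by its edge set, a subset of [complete]. *)
Definition complete : {set {set V}} := [set e : {set V} | #|e| == 2].

Definition adj (F : {set {set V}}) : rel V := fun x y => [set x; y] \in F.

(* The graph formed by the edges of F has as vertices only the endpoints of
   those edges; in particular it is connected when F is empty. *)
Definition edges_connected (F : {set {set V}}) : Prop :=
  {in finset.cover F &, forall x y, connect (adj F) x y}.

(* A cyclic sequence of 2 vertices runs back and forth along a single edge, so
   only those of size at least 3 are cycles of the graph. *)
Definition acyclic (F : {set {set V}}) : Prop :=
  forall c : seq V, ucycle (adj F) c -> size c < 3.

Definition spanning_tree (G T : {set {set V}}) : Prop :=
  [/\ T \subset G, forall x y : V, connect (adj T) x y & acyclic T].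

End Graphs.

Section Game.
Variable V : finType.

(* The completed rounds, in chronological order; each consists of the edges
   claimed by Connector, followed by those claimed by Breaker. *)
Definition history : Type := seq ({set {set V}} * {set {set V}}).

Definition connector_edges (h : history) : {set {set V}} :=
  \bigcup_(r <- h) r.1.

Definition breaker_edges (h : history) : {set {set V}} :=
  \bigcup_(r <- h) r.2.

Definition unclaimed (G : {set {set V}}) (h : history) : {set {set V}} :=
  G :\: (connector_edges h :|: breaker_edges h).

Definition strategy : Type := history -> {set {set V}}.

(* The first k rounds when Connector follows s and Breaker claims b i in
   round i. *)
Fixpoint play (s : strategy) (b : nat -> {set {set V}}) (k : nat) : history :=
  if k is k'.+1 then
    let h := play s b k' in rcons h (s h, b k')
  else [::].

(* Requiring connectedness once per turn is enough: if it holds before and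
   after a turn of at most two edges, then these can be claimed one by one, in
   some order, without ever disconnecting Connector's graph. *)
Definition connector_legal (m : nat) (G : {set {set V}}) (h : history)
    (M : {set {set V}}) : Prop :=
  [/\ M \subset unclaimed G h, #|M| <= m
    & edges_connected (connector_edges h :|: M)].

(* M0 is what Connector has just claimed in the current round. *)
Definition breaker_legal (q : nat) (G : {set {set V}}) (h : history)
    (M0 M : {set {set V}}) : Prop :=
  M \subset unclaimed G h :\: M0 /\ #|M| <= q.

(* In the (m : q) game on G, Connector has a strategy that is legal and claims
   a spanning tree whatever legal moves Breaker makes. The empty move is legal,
   so every finite legal play is a prefix of an infinite one. *)
Definition connector_wins (m q : nat) (G : {set {set V}}) : Prop :=
  exists s : strategy, forall b : nat -> {set {set V}},
    (forall k, let h := play s b k in breaker_legal q G h (s h) (b k)) ->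
    (forall k, let h := play s b k in connector_legal m G h (s h)) /\
    exists (k : nat) (T : {set {set V}}),
      spanning_tree G T /\ T \subset connector_edges (play s b k).

End Game.

Local Open Scope ring_scope.

(* Probability that G_{n,p}, with vertex set 'I_n, satisfies P. *)
Definition gnp_prob (R : realType) (n : nat) (p : R)
    (P : {set {set 'I_n}} -> Prop) : R :=
  \sum_(G : {set {set 'I_n}} | (G \subset complete 'I_n) && `[< P G >])
    \prod_(e in complete 'I_n) (if e \in G then p else 1 - p).

(* Main.v *)
Require Import Defs.
From mathcomp Require Import all_boot all_order all_algebra zify ring lra.
From mathcomp Require Import boolp reals sequences exp.

Set Implicit Arguments.
Unset Strict Implicit.
Unset Printing Implicit Defensive.

(** Connector first spends about n^(1/3) rounds on a star.  From then on she
    repeatedly picks a vertex v outside her graph with the most Breaker edges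
    and reaches it within a bounded number k of rounds; as in the box game, this
    keeps all Breaker degrees outside her graph logarithmic.

    To reach v she uses binary trees of height about k whose leaves are
    neighbours of v, with no Breaker edge.  Given two edge-disjoint trees
    attached to her graph, she claims both edges leading to the roots; this
    opens up four disjoint subtrees, of which Breaker can spoil only two, so she
    again has two trees, of smaller height.

    Such trees exist because in G(n,p) any two disjoint sets of s vertices
    have at least n^delta s common neighbours (for n^(1/3+delta) <= s up to about
    n^(2/3)): starting from N(v), the sets of possible roots grow by a factor
    n^delta per level, while low Breaker degrees spoil only a logarithmic factor
    times s of the new vertices.  After k levels the roots are so numerous that
    the neighbourhood of Connector's graph must contain some.  Giving each node of
    the tree its own colour class of vertices makes the trees edge-disjoint.  All
    the properties of G(n,p) involved say that some vertex or edge exists, and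
    follow from a union bound.

    With r about n^(1/(6k)), everything is measured in powers of the integer
    m = r^2: n is about m^(3k), and p >= 1/m^(2k-2). *)

(** * Spanning trees *)

Section SpanningTrees.
Variable V : finType.
Implicit Types (F T : {set {set V}}) (x y : V).

Lemma adj_sym F : symmetric (adj F).
Proof. by move=> x y; rewrite /adj setUC. Qed.

Lemma connect_adj_sym F : connect_sym (adj F).
Proof. exact/sym_connect_sym/adj_sym. Qed.

Lemma connect_adjS F F' x y :
  F \subset F' -> connect (adj F) x y -> connect (adj F') x y.
Proof.
move=> /subsetP FF'; apply: connect_sub => z t zt.
by apply/connect1/FF'.
Qed.

Lemma set2_inj x : injective (fun y : V => [set x; y]).
Proof.
move=> y z e; have := set22 x y; have := set22 x z.
by rewrite -{1}e {2}e !inE => /orP[]/eqP-> // /orP[]/eqP->.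
Qed.

(** A path that avoids [x] uses no edge at [x]. *)
Lemma path_adjD1 F x w y s : path (adj F) y s -> x \notin y :: s ->
  path (adj (F :\ [set x; w])) y s.
Proof.
elim: s y => //= z s IH y /andP[yz pzs].
rewrite !inE !negb_or -!/(_ \in _) => /and3P[xy xz xs].
rewrite IH // ?inE ?negb_or ?xz ?xs // andbT.
rewrite /adj !inE -/(adj F y z) yz andbT.
by apply/eqP=> /setP /(_ x); rewrite !inE eqxx /= (negPf xy) (negPf xz).
Qed.

(** The rest of the cycle leads from [y] through [c] back to [x]. Its last edge differs from [xy]
    because [c] is nonempty and misses [y]. *)
Lemma connect_cycleD1 F x y c : ucycle (adj F) [:: x, y & c] -> 0 < size c ->
  connect (adj (F :\ [set x; y])) x y.
Proof.
case/andP=> /= /andP[_ pth] /and3P[xNyc yNc uc] c0.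
rewrite connect_adj_sym; apply/connectP; exists (rcons c x); last first.
  by rewrite last_rcons.
move: pth; rewrite !rcons_path => /andP[pc lx].
rewrite (path_adjD1 _ pc) //= /adj !inE -/(adj F _ _) lx andbT.
have lc : last y c \in c by case: c c0 {xNyc yNc uc pc lx} => //= a l _; apply: mem_last.
apply/eqP=> /setP /(_ (last y c)); rewrite !inE eqxx /=.
case/esym/orP => /eqP lE; last by rewrite -{1}lE lc in yNc.
by move: xNyc; rewrite -{1}lE inE lc orbT.
Qed.

(** An inclusion-minimal connected subset of [F] is acyclic: an edge of a cycle could be dropped,
    its ends staying connected around the cycle. *)
Lemma ex_spanning_tree (G F : {set {set V}}) : F \subset G ->
  (forall x y, connect (adj F) x y) -> exists2 T : {set {set V}}, T \subset F & spanning_tree G T.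
Proof.
move=> FG Fc.
pose P T := [forall x, forall y, connect (adj T) x y].
have PF : P F by apply/forallP=> x; apply/forallP=> y; apply: Fc.
have [T /minsetP[/forallP PT Tmin] TF] := minset_exists PF; exists T => //.
have Tc x y : connect (adj T) x y by have /forallP := PT x.
split=> // [|[|x [|y [|z c]]] // ucT]; first exact: subset_trans FG.
have xyT : [set x; y] \in T by case/andP: ucT => /andP[].
have := connect_cycleD1 ucT isT; set T' := _ :\ _ => xyc.
suff /Tmin : P T' by rewrite subsetDl => /(_ isT) TE; rewrite -TE !inE eqxx in xyT.
apply/forallP=> a; apply/forallP=> b; apply: connect_sub (Tc a b) => s t st.
have [e|ne] := eqVneq [set s; t] [set x; y]; last first.
  by apply: connect1; rewrite /adj !inE ne.
have: s \in [set x; y] by rewrite -e set21.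
rewrite !inE => /orP[]/eqP sE; subst s.
  by rewrite (set2_inj e).
by move: e; rewrite [RHS]setUC => /set2_inj->; rewrite connect_adj_sym.
Qed.
End SpanningTrees.

(** * The game as reachability in a bounded number of rounds *)

Section Forcing.
Variables (V : finType) (u : V) (G : {set {set V}}).
Implicit Types (B C M Q : {set {set V}}) (P : {set {set V}} -> {set {set V}} -> Prop).

Definition avail C B := G :\: (C :|: B).

Definition verts C := u |: finset.cover C.

(** Connection to a fixed root [u] is stronger than the rule of the game, and is kept by adding any
    edge that starts in [verts C]. *)
Definition rooted C := {in finset.cover C, forall x, connect (adj C) u x}.

Definition valid C B := [/\ C \subset G, B \subset G, [disjoint C & B] & rooted C].

(* Connector, about to move with C against B, can bring about P within r rounds. *)
Fixpoint force P r C B : Prop :=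
  if r is r'.+1 then
    P C B \/ exists M, [/\ M \subset avail C B, #|M| <= 2, rooted (C :|: M)
      & forall Q, Q \subset avail (C :|: M) B -> #|Q| <= 2 ->
          force P r' (C :|: M) (B :|: Q)]
  else P C B.

Lemma mem_avail C B e : (e \in avail C B) = [&& e \in G, e \notin C & e \notin B].
Proof. by rewrite !inE negb_or andbC. Qed.

Lemma mem_verts_edge C e x : e \in C -> x \in e -> x \in verts C.
Proof. by move=> eC xe; rewrite !inE; apply/orP; right; apply/bigcupP; exists e. Qed.

Lemma vertsS C C' : C \subset C' -> verts C \subset verts C'.
Proof.
move=> /subsetP CC'; apply/subsetP=> x; rewrite !inE => /orP[->//|/bigcupP[e eC xe]].
by apply/orP; right; apply/bigcupP; exists e => //; apply: CC'.
Qed.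

Lemma rooted_verts C x : rooted C -> x \in verts C -> connect (adj C) u x.
Proof. by move=> rC; rewrite !inE => /orP[/eqP->//|/rC]. Qed.

Lemma rooted_edges_connected C : rooted C -> edges_connected C.
Proof.
move=> rC x y xC yC; apply: connect_trans (rC y yC).
by rewrite connect_adj_sym; apply: rC.
Qed.

Lemma vertsU1 C a c : a \in verts C -> verts ([set a; c] |: C) = c |: verts C.
Proof.
move=> aC; apply/setP => x; rewrite !inE /finset.cover bigcup_setU big_set1 !inE.
rewrite !inE /finset.cover in aC.
by case: (eqVneq x a) aC => [->|_]; case: (_ == u); case: (_ == c) => //=; rewrite ?orbT // => ->; rewrite ?orbT.
Qed.

Lemma rootedU1 C a c : a \in verts C -> rooted C -> rooted ([set a; c] |: C).
Proof.
move=> aC rC x xc.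
have sC : C \subset [set a; c] |: C by apply: subsetUr.
have : x \in verts ([set a; c] |: C) by rewrite !inE xc orbT.
rewrite vertsU1 // in_setU1 => /orP[/eqP->|/(rooted_verts rC)]; last exact: connect_adjS.
apply: (connect_trans (connect_adjS sC (rooted_verts rC aC))).
by apply: connect1; rewrite /adj setU11.
Qed.

Lemma force_mono P P' r C B :
  (forall C B, P C B -> P' C B) -> force P r C B -> force P' r C B.
Proof.
move=> PP'; elim: r C B => [|r IH] C B /=; first exact: PP'.
case=> [/PP'|[M [? ? ? MP]]]; first by left.
by right; exists M; split=> // Q ? ?; apply/IH/MP.
Qed.

Lemma force_now P r C B : P C B -> force P r C B.
Proof. by case: r => //= r PCB; left. Qed.

Lemma force_trans P P' r r' C B :
  force P r C B -> (forall C B, P C B -> force P' r' C B) -> force P' (r + r') C B.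
Proof.
move=> FP PP'; have leqF (i j : nat) C' B' : i <= j -> force P' i C' B' -> force P' j C' B'.
  elim: j i C' B' => [|j IH] [|i] C' B' //= ij; first by left.
  by case=> [|[M [? ? ? MP]]]; [left | right; exists M; split=> // Q ? ?; apply/IH/MP].
elim: r C B FP => [|r IH] C B /=; first exact: PP'.
case=> [/PP' F|[M [? ? ? MP]]]; first by apply: (leqF r' (r + r').+1) => //; lia.
by right; exists M; split=> // Q ? ?; apply/IH/MP.
Qed.

Lemma valid_step C B M Q : valid C B -> M \subset avail C B -> rooted (C :|: M) ->
  Q \subset avail (C :|: M) B -> valid (C :|: M) (B :|: Q).
Proof.
case=> CG BG CB _ Mf rM Qf; split=> //.
- by rewrite subUset CG (subset_trans Mf) ?subsetDl.
- by rewrite subUset BG (subset_trans Qf) ?subsetDl.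
rewrite disjoints_subset; apply/subsetP => e eCM; rewrite !inE negb_or; apply/andP; split.
  move: eCM; rewrite inE => /orP[eC|/(subsetP Mf)]; first by rewrite (disjointFr CB).
  by rewrite mem_avail => /and3P[].
by apply: contraL eCM => /(subsetP Qf); rewrite mem_avail => /and3P[].
Qed.

(** Legal play keeps these facts, so any goal may be strengthened by them; this allows phases of
    play to be chained. *)
Lemma force_track P r C B : valid C B -> force P r C B ->
  force (fun C' B' => [/\ P C' B', valid C' B', C \subset C', B \subset B'
                        & #|B' :\: B| <= 2 * r]) r C B.
Proof.
elim: r C B => [|r IH] C B vCB /=; first by move=> PCB; split; rewrite // setDv cards0.
case=> [PCB|[M [Mf M2 rM MP]]]; first by left; split; rewrite // setDv cards0.
right; exists M; split=> // Q Qf Q2.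
apply: force_mono (IH _ _ (valid_step vCB Mf rM Qf) (MP Q Qf Q2)) => C' B' [? ? sC sB c].
split=> //; first by apply: subset_trans sC; apply: subsetUl.
  by apply: subset_trans sB; apply: subsetUl.
apply: leq_trans (_ : #|Q :|: (B' :\: (B :|: Q))| <= _); last first.
  by rewrite mulnS; apply: leq_trans (leq_card_setU _ _) (leq_add Q2 c).
apply/subset_leq_card/subsetP => e; rewrite !inE.
by case: (e \in Q); case: (e \in B).
Qed.

(** At each history the strategy chooses a move after which the goal is still forced with one round
    less. Connector's final graph then spans, and a spanning tree is extracted from it. *)
Lemma force_connector_wins N :
  force (fun C _ => [set: V] \subset verts C) N finset.set0 finset.set0 ->
  connector_wins 2 2 G.
Proof.
set P := (X in force X) => FN.
pose step r (h : history V) M :=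
  [/\ M \subset unclaimed G h, #|M| <= 2, rooted (connector_edges h :|: M)
    & forall Q, Q \subset unclaimed G h :\: M -> #|Q| <= 2 ->
        force P r (connector_edges h :|: M) (breaker_edges h :|: Q)].
(* The remaining budget is read off the length of the history. The default, the empty move, is legal
   in every valid position. *)
pose s (h : history V) : {set {set V}} :=
  if pselect (exists M, step (N - size h).-1 h M) is left ex then sval (cid ex)
  else finset.set0.
exists s => b bl.
have s_step h : (exists M, step (N - size h).-1 h M) -> step (N - size h).-1 h (s h).
  by move=> ex; rewrite /s; case: pselect => // ex'; case: (cid ex').
have szE k : size (play s b k) = k by elim: k => //= k IH; rewrite size_rcons IH.
have cE k : connector_edges (play s b k.+1) = connector_edges (play s b k) :|: s (play s b k).
  by rewrite /connector_edges /= -cats1 big_cat big_seq1.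
have bE k : breaker_edges (play s b k.+1) = breaker_edges (play s b k) :|: b k.
  by rewrite /breaker_edges /= -cats1 big_cat big_seq1.
have moveE h M : unclaimed G h :\: M = avail (connector_edges h :|: M) (breaker_edges h).
  by apply/setP => e; rewrite !inE; do !case: (e \in _).
have s_ok k : let h := play s b k in valid (connector_edges h) (breaker_edges h) ->
  [/\ s h \subset unclaimed G h, #|s h| <= 2 & rooted (connector_edges h :|: s h)].
  move=> h [_ _ _ rh]; rewrite /s; case: pselect => [ex|_]; last first.
    by rewrite sub0set cards0 finset.setU0.
  by case: (svalP (cid ex)).
have inv k : k <= N -> let h := play s b k in
  valid (connector_edges h) (breaker_edges h) /\
  force P (N - k) (connector_edges h) (breaker_edges h).
  elim: k => [_|k IH kN] /=.
    rewrite subn0 /connector_edges /breaker_edges !big_nil; split=> //.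
    by split; rewrite ?disjoints_subset ?sub0set // => x /bigcupP[e]; rewrite inE.
  have [vk Fk] := IH (ltnW kN); have [sf s2 rs] := s_ok k vk.
  have [bf b2] := bl k.
  have vk1 : valid (connector_edges (play s b k.+1)) (breaker_edges (play s b k.+1)).
    by rewrite cE bE; apply: valid_step => //; rewrite -moveE.
  split; first exact: vk1.
  have : P (connector_edges (play s b k)) (breaker_edges (play s b k)) \/
    exists M, step (N - k).-1 (play s b k) M.
    move: Fk; have -> : N - k = (N - k).-1.+1 by lia.
    case=> [|[M [Mf M2 rM MP]]]; [by left | right].
    by exists M; split=> // Q; rewrite moveE; apply: MP.
  (* Once all vertices are covered they stay covered, whatever is claimed. *)
  case=> [Pk|ex].
    by apply: force_now; apply: subset_trans Pk (vertsS _); rewrite cE subsetUl.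
  rewrite -[rcons _ _]/(play s b k.+1) cE bE (_ : N - k.+1 = (N - k).-1); last by lia.
  move: ex; rewrite -{1}(szE k) => /s_step[_ _ _]; rewrite szE; exact.
(* Moves must be legal in every round, also after round [N]. *)
have invE k : valid (connector_edges (play s b k)) (breaker_edges (play s b k)).
  have [/inv[]//|/ltnW/subnKC<-] := leqP k N.
  elim: (k - N) => [|i IH]; first by rewrite addn0; have [] := inv N (leqnn _).
  rewrite addnS cE bE; have [sf s2 rs] := s_ok _ IH; have [bf b2] := bl (N + i).
  by apply: valid_step => //; rewrite -moveE.
split=> [k|].
  have [sf s2 rs] := s_ok _ (invE k); split=> //; exact: rooted_edges_connected.
exists N; have [[CG _ _ rN]] := inv N (leqnn _); rewrite subnn => PN.
have [|T TC sT] := ex_spanning_tree CG; last by exists T.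
have uc x : connect (adj (connector_edges (play s b N))) u x.
  by apply: rooted_verts => //; apply: (subsetP PN); rewrite inE.
by move=> x y; apply: connect_trans (uc y); rewrite connect_adj_sym.
Qed.

End Forcing.

(** * Binary trees in the game *)

Section Branches.
Variables (V : finType) (u v : V) (G : {set {set V}}).
Implicit Types (B C E Q : {set {set V}}).

(* E is the edge set of a path from a to c followed by a complete binary tree
   of height h rooted at c, all of whose leaves are joined to v. *)
Fixpoint branch h a E : Prop :=
  if h is h'.+1 then
    exists c E0 E1, [/\ branch h' c E0, branch h' c E1, [disjoint E0 & E1],
      [set a; c] \notin E0 :|: E1 & E = [set a; c] |: (E0 :|: E1)]
  else exists c, E = [set [set a; c]; [set c; v]].

Definition two_branches h C B : Prop :=
  exists a0 a1 E0 E1, [/\ a0 \in verts u C /\ a1 \in verts u C,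
    branch h a0 E0, branch h a1 E1, [disjoint E0 & E1]
    & E0 :|: E1 \subset avail G C B].

(* Connector enters both branches; of the four branches this opens up, Breaker
   can spoil only two. *)
Lemma force_two_branches h C B : rooted u C -> two_branches h C B ->
  force u G (fun C' _ => v \in verts u C') h.+1 C B.
Proof.
elim: h C B => [|h IH] C B rC [a0 [a1 [E0 [E1 [[a0C a1C] b0 b1 E01 Ef]]]]].
  (* At height 0 a branch is a path through [c] to [v], claimed in a single turn. *)
  case: b0 => c E0E; right; exists E0.
  have CE : C :|: E0 = [set c; v] |: ([set a0; c] |: C).
    by rewrite E0E [LHS]setUC -setUA setUCA.
  have cC : c \in verts u ([set a0; c] |: C) by rewrite vertsU1 // setU11.
  split.
  - by apply: subset_trans Ef; apply: subsetUl.
  - by rewrite E0E cards2; case: (_ != _).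
  - by rewrite CE; apply/rootedU1/rootedU1.
  - by move=> Q _ _ /=; rewrite CE vertsU1 // setU11.
case: b0 => c0 [E00 [E01' [b00 b01 d0 n0 E0E]]].
case: b1 => c1 [E10 [E11 [b10 b11 d1 n1 E1E]]].
(* Connector claims the first edge of each branch. *)
right; set M := [set [set a0; c0]; [set a1; c1]]; exists M.
have CE : C :|: M = [set a1; c1] |: ([set a0; c0] |: C).
  by rewrite [LHS]setUC -setUA setUCA.
have a1C' : a1 \in verts u ([set a0; c0] |: C) by rewrite vertsU1 // in_setU1 a1C orbT.
have rM : rooted u (C :|: M) by rewrite CE; apply/rootedU1/rootedU1.
split=> //.
- apply: subset_trans Ef; rewrite E0E E1E subUset !sub1set !inE !eqxx //=.
  by rewrite ?orbT.
- by rewrite cards2; case: (_ != _).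
move=> Q _ Q2; apply: IH => //.
have c0M : c0 \in verts u (C :|: M) by rewrite CE vertsU1 // in_setU1 vertsU1 // setU11 orbT.
have c1M : c1 \in verts u (C :|: M) by rewrite CE vertsU1 // setU11.
have MF : E00 :|: E01' :|: (E10 :|: E11) \subset avail G C B :\: M.
  have i0 : [set a0; c0] \in E0 by rewrite E0E setU11.
  have i1 : [set a1; c1] \in E1 by rewrite E1E setU11.
  have s0 : E00 :|: E01' \subset E0 by rewrite E0E subsetUr.
  have s1 : E10 :|: E11 \subset E1 by rewrite E1E subsetUr.
  rewrite subsetD; apply/andP; split.
    by apply: subset_trans Ef; apply: setUSS.
  rewrite disjoints_subset; apply/subsetP => e /setUP[] eE; rewrite !inE negb_or.
    have eE0 := subsetP s0 _ eE.
    rewrite (contraNneq _ n0) => [|<- //]; apply: contraTneq eE0 => ->.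
    by rewrite (disjointFl E01).
  have eE1 := subsetP s1 _ eE.
  rewrite andbC (contraNneq _ n1) => [|<- //]; apply: contraTneq eE1 => ->.
  by rewrite (disjointFr E01).
(* Any two disjoint subbranches that Breaker's reply [Q] misses continue the induction. *)
have pick a a' E E' : a \in verts u (C :|: M) -> a' \in verts u (C :|: M) ->
    branch h a E -> branch h a' E' -> [disjoint E & E'] ->
    E \subset E00 :|: E01' :|: (E10 :|: E11) -> E' \subset E00 :|: E01' :|: (E10 :|: E11) ->
    #|E :&: Q| = 0 -> #|E' :&: Q| = 0 -> two_branches h (C :|: M) (B :|: Q).
  move=> aM a'M bE bE' dE sE sE' /eqP; rewrite cards_eq0 => /eqP EQ.
  move=> /eqP; rewrite cards_eq0 => /eqP E'Q.
  exists a, a', E, E'; split=> //; apply/subsetP => e eE.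
  have: e \in avail G C B :\: M.
    by apply: (subsetP MF); case/setUP: eE; apply/subsetP.
  have: e \notin Q.
    by apply/negP=> eQ; case/setUP: eE => ?;
      [have := in_set0 e; rewrite -EQ | have := in_set0 e; rewrite -E'Q];
      rewrite inE eQ andbT => /negP.
  rewrite in_setD !mem_avail (in_setU _ C) (in_setU _ B) !negb_or.
  by move=> -> /andP[-> /and3P[-> -> ->]].
have dd : [disjoint E00 :|: E01' & E10 :|: E11].
  move: E01; rewrite E0E E1E; apply: disjointW; exact: subsetUr.
(* The four subbranches are edge-disjoint, so the two edges of [Q] meet at most two of them. *)
have sum : #|E00 :&: Q| + #|E01' :&: Q| + (#|E10 :&: Q| + #|E11 :&: Q|) <= 2.
  apply: leq_trans Q2.
  have U (X Y : {set {set V}}) : [disjoint X & Y] ->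
      #|X :&: Q| + #|Y :&: Q| = #|(X :|: Y) :&: Q|.
    move=> dXY; rewrite setIUl cardsU (_ : X :&: Q :&: (Y :&: Q) = finset.set0) ?cards0 ?subn0 //.
    by apply: disjoint_setI0; apply: disjointW dXY; rewrite ?subsetIl.
  by rewrite !U // subset_leq_card // subsetIr.
have [[? ?] [? ?]] : ((E00 \subset E00 :|: E01' :|: (E10 :|: E11)) *
                 (E01' \subset E00 :|: E01' :|: (E10 :|: E11)))%type *
               ((E10 \subset E00 :|: E01' :|: (E10 :|: E11)) *
                (E11 \subset E00 :|: E01' :|: (E10 :|: E11)))%type.
  by split; split; apply/subsetP=> e; rewrite !inE => ->; rewrite ?orbT.
have D (X Y : {set {set V}}) : X \subset E00 :|: E01' -> Y \subset E10 :|: E11 -> [disjoint X & Y].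
  by move=> ? ?; apply: disjointW dd.
have one0 (a b c d : nat) : a + b + (c + d) <= 2 -> 0 < a + b -> 0 < c -> d = 0 by clear; lia.
have both0 (a b c d : nat) : a + b + (c + d) <= 2 -> 0 < a -> 0 < b -> c = 0 /\ d = 0 by clear; lia.
case: (posnP #|E00 :&: Q|) => p00; case: (posnP #|E01' :&: Q|) => p01.
- exact: (pick c0 c0 E00 E01').
- case: (posnP #|E10 :&: Q|) => p10.
    by apply: (pick c0 c1 E00 E10) => //; apply: D; rewrite ?subsetUl ?subsetUr.
  have p11 := one0 _ _ _ _ sum ltac:(by rewrite addn_gt0 ?p00 ?p01 ?orbT) p10.
  by apply: (pick c0 c1 E00 E11) => //; apply: D; rewrite ?subsetUl ?subsetUr.
- case: (posnP #|E10 :&: Q|) => p10.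
    by apply: (pick c0 c1 E01' E10) => //; apply: D; rewrite ?subsetUl ?subsetUr.
  have p11 := one0 _ _ _ _ sum ltac:(by rewrite addn_gt0 ?p00 ?p01 ?orbT) p10.
  by apply: (pick c0 c1 E01' E11) => //; apply: D; rewrite ?subsetUl ?subsetUr.
- have [p10 p11] := both0 _ _ _ _ sum p00 p01.
  exact: (pick c1 c1 E10 E11).
Qed.

End Branches.

(** * Coloured trees *)

(** Heap numbering of a binary tree: going to the parent halves the index, so ancestors are iterated
    halves. *)
Fixpoint descendant h (s i : nat) : bool :=
  (i == s) || if h is h'.+1 then descendant h' s.*2 i || descendant h' s.*2.+1 i else false.

Lemma descendant_divn h s i : descendant h s i -> exists j, i %/ 2 ^ j = s.
Proof.
elim: h s => [|h IH] s /=; first by rewrite orbF => /eqP->; exists 0; rewrite divn1.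
case/or3P=> [/eqP->|/IH[j ij]|/IH[j ij]]; first by exists 0; rewrite divn1.
  by exists j.+1; rewrite expnSr divnMA ij -muln2 mulnK.
by exists j.+1; rewrite expnSr divnMA ij -addn1 -muln2 divnMDl // addn0.
Qed.

Lemma leq_descendant h s i : descendant h s i -> s <= i.
Proof. by case/descendant_divn=> j <-; apply: leq_div. Qed.

(** Otherwise one of the siblings 2s and 2s+1 would be an iterated half of the other. But 2s+1
    exceeds 2s, and 2s exceeds s, the rounded half of 2s+1, since s > 0. *)
Lemma descendant_disjoint h h' s i : 0 < s ->
  descendant h s.*2 i -> descendant h' s.*2.+1 i -> false.
Proof.
move=> s0 /descendant_divn[j ij] /descendant_divn[j' ij'].
have [jj'|j'j] := leqP j j'.
  have := leq_div s.*2 (2 ^ (j' - j)).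
  rewrite -{1}ij -divnMA -expnD subnKC // ij'; lia.
have le2 : 2 ^ 1 <= 2 ^ (j - j') by rewrite leq_exp2l // subn_gt0.
have := leq_div2l s.*2.+1 (isT : 0 < 2 ^ 1) le2.
have -> : s.*2.+1 %/ 2 ^ (j - j') = s.*2 by rewrite -ij' -divnMA -expnD subnKC ?ij // ltnW.
rewrite expn1 divn2 /=; lia.
Qed.

Section Trees.
Variables (V : finType) (v : V) (A : {set V}) (col : V -> nat).
Implicit Types (E : {set {set V}}).

(* E is the edge set of a complete binary tree of height h rooted at x, together
   with the edges from its leaves to v.  The tree lies outside A, and its vertices
   are coloured as in a binary heap: below colour s come colours 2s and 2s+1. *)
Fixpoint tree h s x E : Prop :=
  [/\ x \notin A, x != v, col x = s
    & if h is h'.+1 then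
        exists c0 c1 E0 E1, [/\ tree h' s.*2 c0 E0, tree h' s.*2.+1 c1 E1
          & E = ([set x; c0] |: E0) :|: ([set x; c1] |: E1)]
      else E = [set [set x; v]]].

(** All vertices other than [v] that a tree of this height and colour could use. The set depends on
    colours only, whichever tree is chosen. *)
Definition inner h s x := [&& x \notin A, x != v & descendant h s (col x)].

Lemma tree_root h s x E : tree h s x E -> [/\ x \notin A, x != v & col x = s].
Proof. by case: h => [|h] []. Qed.

Lemma tree_inner h s x E : tree h s x E -> inner h s x.
Proof. by case/tree_root=> xA xv xs; rewrite /inner xA xv xs; case: h => [|h] /=; rewrite eqxx. Qed.

Lemma inner_left h s x : inner h s.*2 x -> inner h.+1 s x.
Proof. by case/and3P=> xA xv d; rewrite /inner xA xv /= d orbT. Qed.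

Lemma inner_right h s x : inner h s.*2.+1 x -> inner h.+1 s x.
Proof. by case/and3P=> xA xv d; rewrite /inner xA xv /= d !orbT. Qed.

Lemma tree_edge h s x E e : tree h s x E -> e \in E ->
  (exists2 y, y \in e & inner h s y) /\ (forall y, y \in e -> y = v \/ inner h s y).
Proof.
elim: h s x E => [|h IH] s x E xE.
  have ix := tree_inner xE; case: xE => _ _ _ -> /set1P->.
  split=> [|y]; first by exists x; rewrite ?set21.
  by rewrite !inE => /orP[]/eqP->; [right | left].
have ix := tree_inner xE; case: xE => _ _ _ [c0 [c1 [E0 [E1 [t0 t1 ->]]]]].
have i0 := inner_left (tree_inner t0); have i1 := inner_right (tree_inner t1).
case/setUP=> /setU1P[->|eE].
- split=> [|y]; first by exists x; rewrite ?set21.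
  by rewrite !inE => /orP[]/eqP->; right.
- have [[y ye yi] all] := IH _ _ _ t0 eE.
  by split=> [|z /all[|/inner_left]]; [exists y => //; apply: inner_left | left | right].
- split=> [|y]; first by exists x; rewrite ?set21.
  by rewrite !inE => /orP[]/eqP->; right.
- have [[y ye yi] all] := IH _ _ _ t1 eE.
  by split=> [|z /all[|/inner_right]]; [exists y => //; apply: inner_right | left | right].
Qed.

(** Each edge on the left has an end coloured below 2s. The ends of edges on the right are [a1],
    [v], or coloured below 2s+1, and none of these qualifies. *)
Lemma tree_disjoint h s x0 x1 a0 a1 E0 E1 : 0 < s ->
  tree h s.*2 x0 E0 -> tree h s.*2.+1 x1 E1 -> ~~ inner h s.*2 a1 ->
  [disjoint [set a0; x0] |: E0 & [set a1; x1] |: E1].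
Proof.
move=> s0 t0 t1 a1N; rewrite disjoints_subset; apply/subsetP => e e0; rewrite inE.
apply/negP=> e1.
have [y ye yi] : exists2 y, y \in e & inner h s.*2 y.
  case/setU1P: e0 => [->|/(tree_edge t0)[]//].
  by exists x0; rewrite ?set22 ?(tree_inner t0).
have disj z : inner h s.*2 z -> inner h s.*2.+1 z -> false.
  by case/and3P=> _ _ d /and3P[_ _]; apply: descendant_disjoint s0 d.
have : [\/ y = a1, y = v | inner h s.*2.+1 y].
  case/setU1P: e1 ye => [->|/(tree_edge t1)[_ al] /al[]]; last 2 first.
  - by constructor 2.
  - by constructor 3.
  rewrite !inE => /orP[]/eqP->; [by constructor 1|constructor 3; exact: tree_inner t1].
case=> [ya|yv|/(disj _ yi)//]; first by rewrite -ya yi in a1N.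
by move: yi; rewrite yv /inner eqxx andbF.
Qed.

Lemma inner_parent h s x : 0 < s -> col x = s -> ~~ inner h s.*2 x /\ ~~ inner h s.*2.+1 x.
Proof.
move=> s0 xs; split; apply/negP=> /and3P[_ _ /leq_descendant]; rewrite xs; lia.
Qed.

(** Going down from the root, each parent has a colour smaller than all colours beneath it, so the
    linking edges are new and the two halves are disjoint. *)
Lemma tree_branch h s x a E : 0 < s -> tree h s x E -> a != v -> ~~ inner h s a ->
  branch v h a ([set a; x] |: E).
Proof.
elim: h s x a E => [|h IH] s x a E s0 xE av ai.
  by case: xE => _ _ _ ->; exists x.
have ix := tree_inner xE; case: (xE) => xA xv xs [c0 [c1 [E0 [E1 [t0 t1 EE]]]]].
have [xi0 xi1] := inner_parent h s0 xs.
exists x, ([set x; c0] |: E0), ([set x; c1] |: E1); split=> //.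
- by apply: IH t0 xv xi0; lia.
- by apply: IH t1 xv xi1; lia.
- exact: tree_disjoint s0 t0 t1 xi0.
- rewrite -EE; apply/negP=> /(tree_edge xE)[_ /(_ a)].
  rewrite set21 => /(_ isT)[/eqP|]; exact/negP.
- by rewrite EE.
Qed.

End Trees.

Section Attached.
Variables (V : finType) (u v : V) (G C B : {set {set V}}) (col : V -> nat).
Hypothesis vNC : v \notin verts u C.

Lemma two_branches_trees h s a0 a1 x0 x1 E0 E1 : 0 < s ->
  a0 \in verts u C -> a1 \in verts u C ->
  tree v (verts u C) col h s.*2 x0 E0 -> tree v (verts u C) col h s.*2.+1 x1 E1 ->
  [set a0; x0] \in avail G C B -> [set a1; x1] \in avail G C B ->
  E0 \subset avail G C B -> E1 \subset avail G C B ->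
  two_branches u v G h C B.
Proof.
move=> s0 a0C a1C t0 t1 e0 e1 f0 f1.
have Ni a k s' : a \in verts u C -> a != v /\ ~~ inner v (verts u C) col k s' a.
  by move=> aC; rewrite /inner aC; split=> //; apply: contraNneq vNC => <-.
have [a0v a0N] := Ni a0 h s.*2 a0C; have [a1v a1N] := Ni a1 h s.*2.+1 a1C.
exists a0, a1, ([set a0; x0] |: E0), ([set a1; x1] |: E1); split=> //.
- by apply: tree_branch t0 a0v a0N; move: s0; clear; lia.
- by apply: tree_branch t1 a1v a1N; clear; lia.
- by apply: tree_disjoint s0 t0 t1 _; case: (Ni a1 h s.*2 a1C).
- by rewrite !subUset !sub1set e0 e1 f0 f1.
Qed.

End Attached.

(** * Breaker degrees and the box game *)

Section Degrees.
Variable V : finType.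
Implicit Types (B F : {set {set V}}) (X : {set V}) (x y : V).

Definition degree B x := #|[set e in B | x \in e]|.

Definition nbrs B X := [set y | [exists x in X, [set x; y] \in B]].

Lemma degreeD B B' B0 x :
  degree (B' :\: B0) x <= degree (B :\: B0) x + degree (B' :\: B) x.
Proof.
apply: leq_trans (leq_card_setU _ _); apply/subset_leq_card/subsetP=> e.
by rewrite !inE; case: (e \in B); case: (e \in B'); case: (e \in B0); case: (x \in e).
Qed.

(** Handshake lemma, by double counting. *)
Lemma sum_degree B : B \subset complete V -> \sum_x degree B x = #|B| * 2.
Proof.
move=> /subsetP Bc.
transitivity (\sum_x \sum_(e in B) (x \in e : nat)).
  apply: eq_bigr => x _; rewrite /degree -sum1_card big_mkcond [RHS]big_mkcond /=.
  by apply: eq_bigr => e _; rewrite inE; case: (e \in B) => //; case: (x \in e).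
rewrite exchange_big /= -sum_nat_const; apply: eq_bigr => e /Bc.
by rewrite inE => /eqP<-; rewrite -sum1_card [RHS]big_mkcond.
Qed.

Lemma card_nbrs1 B x : #|[set y | [set x; y] \in B]| <= degree B x.
Proof.
rewrite -(card_imset _ (@set2_inj V x)); apply/subset_leq_card/subsetP=> e.
by case/imsetP=> y; rewrite inE => xyB ->; rewrite inE xyB set21.
Qed.

Lemma card_nbrs B X : #|nbrs B X| <= \sum_(x in X) degree B x.
Proof.
have -> : nbrs B X = \bigcup_(x in X) [set y | [set x; y] \in B].
  apply/setP => y; rewrite inE; apply/existsP/bigcupP => [[x /andP[xX xyB]]|[x xX]].
    by exists x; rewrite ?inE.
  by rewrite inE => xyB; exists x; rewrite xX.
apply: leq_trans (_ : \sum_(x in X) #|[set y | [set x; y] \in B]| <= _).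
  elim/big_rec2: _ => [|x n Y _ le]; first by rewrite cards0.
  by apply: leq_trans (leq_card_setU _ _) _; rewrite leq_add2l.
by apply: leq_sum => x _; apply: card_nbrs1.
Qed.

Lemma card_cover B : B \subset complete V -> #|finset.cover B| <= #|B| * 2.
Proof.
move=> /subsetP Bc; apply: leq_trans (leq_card_cover B) _.
by rewrite -sum_nat_const; apply: leq_sum => e /Bc; rewrite inE => /eqP->.
Qed.

(** Edges of [B0] obey no degree bound and are counted through their at most [2 * #|B0|] ends. In
    the application [B0] is what Breaker claimed during the opening. *)
Lemma card_nbrsD B B0 X d : B0 \subset complete V ->
  (forall x, x \in X -> degree (B :\: B0) x <= d) ->
  #|nbrs B X| <= #|X| * d + #|B0| * 2.
Proof.
move=> B0c Xd; apply: leq_trans (_ : #|nbrs (B :\: B0) X :|: finset.cover B0| <= _).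
  apply/subset_leq_card/subsetP=> y; rewrite !inE => /existsP[x /andP[xX xyB]].
  have [xyB0|xyB0] := boolP ([set x; y] \in B0).
    by apply/orP; right; apply/bigcupP; exists [set x; y]; rewrite ?set22.
  by apply/orP; left; apply/existsP; exists x; rewrite xX inE xyB0.
apply: leq_trans (leq_card_setU _ _) (leq_add _ (card_cover B0c)).
by apply: leq_trans (card_nbrs _ _) _; rewrite -sum_nat_const leq_sum.
Qed.

(** Markov's inequality: by the handshake lemma, vertices of degree above [d] make up at most half
    of [X]. *)
Lemma card_low_degree B X d : B \subset complete V -> 4 * #|B| <= #|X| * d ->
  #|X| <= 2 * #|[set x in X | degree B x <= d]|.
Proof.
move=> Bc le.
set low := [set x in X | _].
have : #|X :\: low| * d.+1 <= #|B| * 2.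
  rewrite -sum_degree // -sum_nat_const.
  apply: leq_trans (_ : \sum_(x in X :\: low) degree B x <= _).
    apply: leq_sum => x; rewrite !inE => /andP[+ xX].
    by rewrite xX /= -ltnNge.
  by rewrite [leqRHS](bigID (mem (X :\: low))) /= leq_addr.
rewrite -(cardsID low X) (setIidPr _) in le *; last first.
  by apply/subsetP => x; rewrite inE => /andP[].
move: #|low| #|_ :\: _| #|B| le => l h b; clear; nia.
Qed.

End Degrees.

(** * The potential function of the box game *)

Section Potential.
Local Open Scope ring_scope.
Import Order.TTheory GRing.Theory Num.Theory.
Variables (T : finType) (q : nat).
Hypothesis q0 : (0 < q)%N.

(** Small enough that d <= q increments multiply a weight by at most 1 + d/q, large enough that 2qL
    increments multiply it by at least 2^L. *)
Definition base : rat := 1 + (q.*2%:R)^-1.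

Let qr0 : 0 < q%:R :> rat. Proof. by rewrite ltr0n. Qed.

Lemma base_ge1 : 1 <= base.
Proof. by rewrite /base lerDl invr_ge0 ler0n. Qed.

Lemma base_exp_le d : (d <= q)%N -> base ^+ d <= 1 + d%:R / q%:R.
Proof.
elim: d => [|d IH] dq; first by rewrite expr0 mul0r addr0.
have dq' : d%:R <= q%:R :> rat by rewrite ler_nat ltnW.
rewrite exprS; apply: le_trans (ler_wpM2l _ (IH (ltnW dq))) _.
  exact: le_trans base_ge1.
have step (i x : rat) : 0 < i -> x * i <= 1 -> (1 + i / 2) * (1 + x * i) <= 1 + (x + 1) * i.
  by move=> i0 xi; have : x * i * i <= i by [apply: ler_piMl => //; apply: ltW]; lra.
rewrite /base -muln2 natrM -[d.+1%:R]natr1 invfM; apply: step; first by rewrite invr_gt0.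
by rewrite ler_pdivrMr // mul1r.
Qed.

(** Bernoulli's inequality gives [base] ^ (2q) >= 2. *)
Lemma base_exp_ge L : 2 ^+ L <= base ^+ (q.*2 * L).
Proof.
have bern d : 1 + d%:R * (q.*2%:R)^-1 <= base ^+ d.
  elim: d => [|d IH]; first by rewrite expr0 mul0r addr0.
  rewrite exprS; apply: le_trans (ler_wpM2l _ IH); last exact: le_trans base_ge1.
  have : 0 <= d%:R * (q.*2%:R)^-1 * (q.*2%:R)^-1 :> rat by rewrite !mulr_ge0 ?invr_ge0.
  rewrite /base -natr1; lra.
rewrite exprM lerXn2r ?nnegrE //; first exact/exprn_ge0/(le_trans _ base_ge1).
by apply: le_trans (bern _); rewrite mulfV // pnatr_eq0 double_eq0 -lt0n.
Qed.

(* The box game: deleting a point of maximal weight pays for q increments. *)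
Lemma potential_step (O O' : {set T}) (d g : T -> nat) (v : T) :
  v \in O -> {in O, forall x, (d x <= d v)%N} -> O' \subset O :\ v ->
  (\sum_x g x <= q)%N ->
  \sum_(x in O') base ^+ (d x + g x) <= \sum_(x in O) base ^+ d x.
Proof.
move=> vO dmax O'O sg; rewrite (big_setD1 v vO) /=.
have b0 n : 0 <= base ^+ n by apply/exprn_ge0/(le_trans _ base_ge1).
apply: le_trans (_ : \sum_(x in O :\ v) base ^+ (d x + g x) <= _).
  rewrite [leRHS](big_setID O') /= (setIidPr O'O) lerDl.
  by apply: sumr_ge0.
(* The weight of [x] grows by at most the fraction [g x / q] of itself, hence of the weight of [v].
   These fractions sum to at most 1, so the total gain is at most the deleted weight. *)
apply: le_trans (_ : \sum_(x in O :\ v) (base ^+ d x + base ^+ d v * (g x)%:R / q%:R) <= _).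
  apply: ler_sum => x /setD1P[_ xO].
  have gx : (g x <= q)%N by apply: leq_trans sg; rewrite (bigD1 x) //= leq_addr.
  rewrite exprD; apply: le_trans (ler_wpM2l (b0 _) (base_exp_le gx)) _.
  rewrite mulrDr mulr1 lerD2l mulrA; apply: ler_wpM2r; first by rewrite invr_ge0 ltW.
  apply: ler_wpM2r => //; apply: ler_weXn2l; [exact: base_ge1 | exact: dmax].
rewrite big_split /= addrC lerD2r -mulr_suml -mulr_sumr.
rewrite ler_pdivrMr //; apply: ler_wpM2l => //.
rewrite -natr_sum ler_nat; apply: leq_trans sg.
rewrite [leqRHS](bigID (mem (O :\ v))) /= leq_addr //.
Qed.

End Potential.

(** * Reaching a vertex in an expander *)

Lemma subset_of_card (T : finType) (X : {set T}) j : j <= #|X| ->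
  exists2 Y : {set T}, Y \subset X & #|Y| = j.
Proof.
move=> jX; exists [set x in take j (enum X)].
  by apply/subsetP=> x; rewrite inE => /mem_take; rewrite mem_enum.
rewrite cardsE; have /card_uniqP-> : uniq (take j (enum X)) by rewrite take_uniq ?enum_uniq.
by rewrite size_take -cardE; case: ltngtP jX.
Qed.

Section Expansion.
Variables (V : finType) (col : V -> nat) (k m : nat).
Implicit Types (G : {set {set V}}) (X Y Z : {set V}).

(* col is meant to split the vertices into 2 ^ k.+1 classes of linear size. *)
Definition expands G X b : Prop :=
  forall i Y, i < 2 ^ k.+1 -> #|Y| <= b ->
    exists y, [/\ col y = i, y \notin Y & y \in nbrs G X].

Definition joint_expands G X0 X1 b : Prop :=
  forall i Y, i < 2 ^ k.+1 -> #|Y| <= b ->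
    exists y, [/\ col y = i, y \notin Y, y \in nbrs G X0 & y \in nbrs G X1].

(** [expander_single] yields the neighbours of [v] and of Connector's graph, [expander_joint] climbs
    one tree level, and [expander_dense] makes the last level meet the neighbourhood of her graph.
    The arbitrary excluded set [Y] absorbs what Breaker has spoiled. *)
Record expander G : Prop := Expander {
  expander_complete : G \subset complete V;
  expander_single : forall X, 0 < #|X| <= m ^ k ->
    expands G X (2 * m ^ k.+1 * #|X|);
  expander_joint : forall X0 X1, [disjoint X0 & X1] -> #|X0| = #|X1| ->
    m ^ k.+1 <= #|X0| <= m ^ (k.*2 - 2) -> joint_expands G X0 X1 (m ^ 2 * #|X0|);
  expander_dense : forall X Z, [disjoint X & Z] ->
    #|X| = m ^ (k.*2 - 1) -> #|Z| = m ^ (k.*2 - 1) -> exists2 z, z \in Z & z \in nbrs G X }.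

End Expansion.

(** * Layers of tree roots around a vertex assumed out of reach *)

Section Levels.
Variables (V : finType) (u v : V) (G B0 C B : {set {set V}}).
Variables (col : V -> nat) (k m D : nat).
Implicit Types (F : {set {set V}}) (X : {set V}) (x y : V).
Hypothesis k3 : 3 <= k.
Hypothesis m300 : 300 <= m.
Hypothesis km : 8 * k <= m.
Hypothesis Dm : 12 * D <= m.
Hypothesis Gexp : expander col k m G.
Hypothesis vCB : valid u G C B.
Local Notation A := (verts u C).
Hypothesis vNA : v \notin A.
Hypothesis B0B : B0 \subset B.
Hypothesis B0m : #|B0| <= 4 * m ^ k.
Hypothesis degD : forall x, x \notin A -> degree (B :\: B0) x <= D.
Hypothesis BA : #|B| <= 2 * k * #|A|.
Hypothesis mA : 2 * m ^ k <= #|A|.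

Let Gc := expander_complete Gexp.
Let BG : B \subset G. Proof. by case: vCB. Qed.
Let Bc : B \subset complete V. Proof. exact: subset_trans BG Gc. Qed.
Let B0c : B0 \subset complete V. Proof. exact: subset_trans B0B Bc. Qed.
Let rC : rooted u C. Proof. by case: vCB. Qed.

Let mM : m ^ k.+1 = m * m ^ k. Proof. by rewrite expnS. Qed.
Let M1 : 0 < m ^ k. Proof. by rewrite expn_gt0; move: m300; lia. Qed.

Lemma avail_outside x y : x \notin A -> [set x; y] \in G :\: B -> [set x; y] \in avail G C B.
Proof.
move=> xA; rewrite inE => /andP[eB eG]; rewrite mem_avail eG eB andbT /=.
by apply: contra xA => eC; apply: mem_verts_edge eC _; rewrite set21.
Qed.

Lemma edge_neq x y : [set x; y] \in G -> x != y.
Proof.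
by move/(subsetP Gc); rewrite inE cards2; case: (x != y).
Qed.

Lemma mem_nbrs F X y : (y \in nbrs F X) -> exists2 x, x \in X & [set x; y] \in F.
Proof. by rewrite inE => /existsP[x /andP[]]; exists x. Qed.

Lemma nbrsD X y : y \in nbrs G X -> y \notin nbrs B X -> y \in nbrs (G :\: B) X.
Proof.
case/mem_nbrs=> x xX xyG yN; rewrite inE; apply/existsP; exists x; rewrite xX inE xyG andbT /=.
by apply: contra yN => xyB; rewrite inE; apply/existsP; exists x; rewrite xX.
Qed.

Hypothesis slow : ~ force u G (fun C' _ => v \in verts u C') k C B.

(** The argument is by contradiction from [slow]: two branches of height [h] would bring Connector
    to [v] in h+1 <= k rounds. *)
Let no_branches h : h < k -> ~ two_branches u v G h C B.
Proof.
move=> hk /(force_two_branches rC) F; apply: slow; rewrite -(subnKC hk).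
by apply: force_trans F _ => C' B'; apply: force_now.
Qed.

Let no_edge y : [set y; v] \in G :\: B -> y \notin A.
Proof.
move=> yv; apply/negP => yA; apply: slow; rewrite -(subnKC (ltnW (ltnW k3))).
apply: (@force_trans _ _ _ (fun C' _ => v \in verts u C')) => [|C' B']; last exact: force_now.
right; exists [set [set y; v]]; split; rewrite ?cards1 //.
- by rewrite sub1set setUC avail_outside // setUC.
- by rewrite setUC; apply: rootedU1.
- by move=> Q _ _; rewrite /= setUC vertsU1 // setU11.
Qed.

(** Trees for different vertices of one layer may overlap; disjoint trees are always taken from
    layers of sibling colours. *)
Definition layer h s (X : {set V}) : Prop :=
  forall x, x \in X -> exists2 E, tree v A col h s x E & E \subset avail G C B.

Lemma layer_card_nbrs h s X : layer h s X -> #|nbrs B X| <= #|X| * D + 8 * m ^ k.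
Proof.
move=> lX; apply: leq_trans (card_nbrsD B0c _) (leq_add (leqnn _) _).
  by move=> x /lX[E /tree_root[xA _ _] _]; apply: degD.
by move: B0m; clear; lia.
Qed.

Lemma layer_disjoint h h' s s' X X' : s != s' -> layer h s X -> layer h' s' X' -> [disjoint X & X'].
Proof.
move=> ss' lX lX'; rewrite disjoints_subset; apply/subsetP=> x /lX[E /tree_root[_ _ xs] _].
rewrite inE; apply/negP=> /lX'[E' /tree_root[_ _ xs'] _].
by move: ss'; rewrite -xs xs' eqxx.
Qed.

(** A vertex [y] adjacent to both child layers is the root of a taller tree. It lies outside
    Connector's graph, since otherwise the two child trees would hang from [y] itself and form two
    branches. *)
Lemma layerS h s X0 X1 y : h.+1 < k -> 0 < s -> layer h s.*2 X0 -> layer h s.*2.+1 X1 ->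
  col y = s -> y != v -> y \in nbrs (G :\: B) X0 -> y \in nbrs (G :\: B) X1 ->
  exists2 E, tree v A col h.+1 s y E & E \subset avail G C B.
Proof.
move=> hk s0 l0 l1 ys yv /mem_nbrs[x0 x0X x0y] /mem_nbrs[x1 x1X x1y].
have [E0 t0 f0] := l0 _ x0X; have [E1 t1 f1] := l1 _ x1X.
have [x0A _ _] := tree_root t0; have [x1A _ _] := tree_root t1.
have e0 : [set y; x0] \in avail G C B by rewrite setUC avail_outside.
have e1 : [set y; x1] \in avail G C B by rewrite setUC avail_outside.
have yA : y \notin A.
  apply/negP=> yA; apply: (no_branches (ltnW hk)).
  exact: (two_branches_trees vNA s0 yA yA t0 t1 e0 e1 f0 f1).
exists ([set y; x0] |: E0 :|: ([set y; x1] |: E1)).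
  by split=> //; exists x0, x1, E0, E1.
by rewrite !subUset !sub1set e0 e1 f0 f1.
Qed.

(** By induction on the height, each level multiplying the size by [m]. The bound on [s] keeps the
    largest heap index below [s], which is 2^h (s+1) - 1, within the 2^(k+1) colours. *)
Lemma ex_layer h s : h.+1 < k -> 0 < s -> 2 ^ h * s.+1 <= 2 ^ k.+1 ->
  exists2 X : {set V}, layer h s X & #|X| = m ^ (k.+1 + h).
Proof.
elim: h s => [|h IH] s hk s0 sk.
  pose N := [set y | (col y == s) && ([set y; v] \in G :\: B)].
  have [|X XN Xc] := @subset_of_card _ N (m ^ (k.+1 + 0)); last first.
    exists X => // y /(subsetP XN); rewrite inE => /andP[/eqP ys yvGB].
    have yA := no_edge yvGB; exists [set [set y; v]]; last by rewrite sub1set avail_outside.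
    by split=> //; apply: edge_neq; move: yvGB; rewrite inE => /andP[].
  (* If [N] were small, expansion from [v] would give a neighbour of colour [s] outside [N] and not
     joined to [v] by a Breaker edge, which is absurd. *)
  rewrite addn0 leqNgt; apply/negP=> Nm.
  have [|||y [ys yY /mem_nbrs[x /set1P-> vyG]]] :=
    @expander_single _ _ _ _ _ Gexp [set v] _ s (N :|: nbrs B [set v]).
  - by rewrite cards1 M1.
  - by move: sk; rewrite expn0 mul1n.
  - have := @card_nbrsD _ B B0 [set v] D B0c.
    rewrite cards1 => nB; apply: leq_trans (leq_card_setU _ _) _.
    have {}nB : #|nbrs B [set v]| <= 1 * D + #|B0| * 2 by apply: nB => x /set1P->; apply: degD.
    move: nB Nm B0m M1 m300 Dm; rewrite mM.
    move: #|N| #|nbrs _ _| #|B0| (m ^ k) => a b c M; clear; nia.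
  move: yY; rewrite in_setU negb_or inE ys eqxx inE (setUC [set y]) vyG andbT /= negbK.
  by case/andP=> vyB /negP[]; rewrite inE; apply/existsP; exists v; rewrite set11.
have [|||X0 l0 c0] := IH s.*2; [by move: hk; clear; lia|by move: s0; clear; lia| |].
  by apply: leq_trans sk; rewrite expnSr -mulnA leq_pmul2l ?expn_gt0 //; clear; lia.
have [|||X1 l1 c1] := IH s.*2.+1; [by move: hk; clear; lia|by []| |].
  by apply: leq_trans sk; rewrite expnSr -mulnA leq_pmul2l ?expn_gt0 //; clear; lia.
pose N := [set y | [&& col y == s, y != v, y \in nbrs (G :\: B) X0 & y \in nbrs (G :\: B) X1]].
have [|X XN Xc] := @subset_of_card _ N (m ^ (k.+1 + h.+1)); last first.
  exists X => // y /(subsetP XN); rewrite inE => /and4P[/eqP ys yv y0 y1].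
  exact: layerS (ltnW hk) s0 l0 l1 ys yv y0 y1.
rewrite leqNgt; apply/negP=> Nm.
have dX : [disjoint X0 & X1] by apply: layer_disjoint l0 l1; clear; lia.
have [||||y [ys yY y0 y1]] :=
  @expander_joint _ _ _ _ _ Gexp X0 X1 dX _ _ s (N :|: [set v] :|: (nbrs B X0 :|: nbrs B X1)).
- by rewrite c0.
- by rewrite c0 !leq_pexp2l //; move: m300 hk; clear; lia.
- apply: leq_trans sk; apply: leq_trans (leq_pmull _ _); by rewrite ?expn_gt0.
(* The excluded set has size below m|X0| + 1 + 2(D|X0| + 8m^k), which is at most m^2 |X0|. *)
- have n0 := layer_card_nbrs l0; have n1 := layer_card_nbrs l1.
  apply: leq_trans (leq_card_setU _ _) _.
  apply: leq_trans (leq_add (leq_card_setU _ _) (leq_card_setU _ _)) _.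
  have tM : m ^ k.+1 <= #|X0| by rewrite c0 leq_pexp2l ?leq_addr //; move: m300; clear; lia.
  have c01 : #|X1| = #|X0| by rewrite c0.
  have {}Nm : #|N| < m * #|X0| by rewrite c0 -expnS -addnS.
  move: n0 n1 tM c01 Nm M1 m300 Dm; rewrite cards1 mM; clear.
  move: #|N| #|nbrs _ _| #|nbrs _ _| #|X0| #|X1| (m ^ k) => a b c d e M n0 n1 tM ed; subst e; nia.
move: yY; rewrite (in_setU _ (N :|: _)) (in_setU _ N) (in_setU _ (nbrs _ _)) !negb_or.
case/andP=> /andP[yN yv] /andP[y0' y1']; rewrite in_set1 in yv.
by move: yN; rewrite inE ys eqxx yv !nbrsD.
Qed.

(** Vertices of Connector's graph with few Breaker edges have a set [Z] of more than m^2 m^(2k-1)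
    usable neighbours of colour [s]. The two child layers have size m^(2k-1), so most of [Z] is
    adjacent to both. *)
Lemma ex_attached s : 2 <= s <= 3 -> exists a z E,
  [/\ a \in A, tree v A col k.-1 s z E, [set a; z] \in avail G C B & E \subset avail G C B].
Proof.
move=> s23; have kE : k = (k - 2).+2 by move: k3; clear; lia.
have [|||X0 l0 c0] := @ex_layer (k - 2) s.*2; [by move: k3; clear; lia|by move: s23; clear; lia| |].
  by rewrite {2}kE !expnSr -!mulnA leq_pmul2l ?expn_gt0 //; move: s23; clear; lia.
(* As s <= 3, the colour is at most 7, and 2^(k-2) * 8 = 2^(k+1). *)
have [|||X1 l1 c1] := @ex_layer (k - 2) s.*2.+1; [by move: k3; clear; lia|by []| |].
  by rewrite {2}kE !expnSr -!mulnA leq_pmul2l ?expn_gt0 //; move: s23; clear; lia.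
have kk : k.+1 + (k - 2) = k.*2 - 1 by move: k3; clear; lia.
rewrite kk in c0 c1.
pose low := [set x in A | degree B x <= 8 * k].
have low_card : m ^ k <= #|low|.
  (* The threshold 8k is four times the bound 2k on |B| / |A|, so half of [A] qualifies. *)
  have := @card_low_degree _ B A (8 * k) Bc; rewrite -/low.
  move: BA mA; move: #|low| #|B| #|A| => a b c bc mc /(_ ltac:(nia)); lia.
have [A' A'low cA'] := subset_of_card low_card.
pose Z := [set z | (col z == s) && (z \in nbrs (G :\: B) A')].
have Zc : m ^ 2 * m ^ (k.*2 - 1) < #|Z|.
  rewrite ltnNge; apply/negP=> Zc.
  have [|||y [ys yY yA']] := @expander_single _ _ _ _ _ Gexp A' _ s (Z :|: nbrs B A').
  - by rewrite cA' M1 leqnn.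
  - by apply: leq_ltn_trans (_ : 2 ^ 2 <= _); [move: s23 | rewrite leq_exp2l //; move: k3]; clear; lia.
  - apply: leq_trans (leq_card_setU _ _) _; rewrite cA'.
    have nA : #|nbrs B A'| <= m ^ k * (8 * k).
      rewrite -cA' -sum_nat_const; apply: leq_trans (card_nbrs _ _) _; apply: leq_sum => x xA'.
      by have := subsetP A'low _ xA'; rewrite inE => /andP[].
    apply: leq_trans (leq_add Zc nA) _.
    have -> : m ^ 2 * m ^ (k.*2 - 1) = m * m ^ k * m ^ k.
      by rewrite -expnS -!expnD; congr (m ^ _); move: k3; clear; lia.
    rewrite mM; move: km M1 m300; move: (m ^ k); clear; nia.
  move: yY; rewrite inE negb_or => /andP[yZ yN].
  by move: yZ; rewrite inE ys eqxx nbrsD.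
have [z /and4P[zZ zv z0 z1]] : exists z,
    [&& z \in Z, z != v, z \in nbrs (G :\: B) X0 & z \in nbrs (G :\: B) X1].
  apply/existsP; apply: contraLR Zc; rewrite negb_exists -leqNgt => /forallP none.
  (* By density, the vertices of [Z] with no neighbour in [X] are at most m^(2k-1). *)
  have far X s' : layer (k - 2) s' X -> s != s' -> #|X| = m ^ (k.*2 - 1) ->
      #|Z :\: nbrs G X| <= m ^ (k.*2 - 1).
    move=> lX ss' cX; rewrite leqNgt; apply/negP=> /ltnW /subset_of_card[W WZ cW].
    have [|z zW zX] := expander_dense Gexp _ cX cW.
      rewrite disjoint_sym disjoints_subset; apply/subsetP=> z /(subsetP WZ).
      rewrite !inE => /andP[_ /andP[/eqP zs _]]; apply/negP=> /lX[E /tree_root[_ _ zs'] _].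
      by rewrite -zs zs' eqxx in ss'.
    by have := subsetP WZ _ zW; rewrite inE zX.
  have s0 : s != s.*2 by move: s23; clear; lia.
  have s1 : s != s.*2.+1 by clear; lia.
  have f0 := far X0 _ l0 s0 c0; have f1 := far X1 _ l1 s1 c1.
  have n0 := layer_card_nbrs l0; have n1 := layer_card_nbrs l1.
  (* Without a suitable [z], all of [Z] would be covered by [v], the Breaker neighbours of the
     layers and the vertices far from a layer. *)
  apply: leq_trans (_ : #|v |: (nbrs B X0 :|: nbrs B X1) :|:
                         ((Z :\: nbrs G X0) :|: (Z :\: nbrs G X1))| <= _).
    apply/subset_leq_card/subsetP => z zZ; have := none z; rewrite zZ /=.
    rewrite !in_setU in_set1 !in_setD zZ !andbT.
    have := @nbrsD X0 z; have := @nbrsD X1 z.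
    case: (z == v) => //=; case: (z \in nbrs B X0) => //=; case: (z \in nbrs B X1) => //=.
    by case: (z \in nbrs G X0) => //=; case: (z \in nbrs G X1) => //= -> // ->.
  apply: leq_trans (leq_card_setU _ _) _.
  apply: leq_trans (leq_add (leq_card_setU _ _) (leq_card_setU _ _)) _.
  rewrite cards1; move: (leq_card_setU (nbrs B X0) (nbrs B X1)) => [nn _].
  have tM : m ^ k <= m ^ (k.*2 - 1) by rewrite leq_pexp2l; move: k3 m300; clear; lia.
  move: n0 n1 nn f0 f1 tM M1 m300 Dm; rewrite c0 c1; clear.
  move: #|nbrs _ _| #|nbrs _ _| #|_ :|: _| #|_ :\: _| #|_ :\: _| (m ^ k) (m ^ (k.*2 - 1)).
  move=> a b c d e M t.
  move=> n0 n1 nn f0 f1 tM M1 m3 Dm.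
  have h1 : t * (12 * D) <= t * m by rewrite leq_mul2l Dm orbT.
  have h2 : t * m * 300 <= t * m * m by rewrite leq_mul2l m3 orbT.
  rewrite -mulnn; nia.
move: zZ; rewrite inE => /andP[/eqP zs /mem_nbrs[a aA' azGB]].
have [E tE fE] : exists2 E, tree v A col (k - 2).+1 s z E & E \subset avail G C B.
  by apply: layerS l0 l1 zs zv z0 z1; move: k3 s23; clear; lia.
exists a, z, E; split=> //.
- by have := subsetP A'low _ aA'; rewrite inE => /andP[].
- by have -> : k.-1 = (k - 2).+1 by move: k3; clear; lia.
- by rewrite setUC; apply: avail_outside; [case/tree_root: tE | rewrite setUC].
Qed.

(** Attached trees of height k-1 with colours 2 and 3, the children of heap index 1, form two
    branches. *)
Lemma slow_contra : False.
Proof.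
have [a0 [z0 [E0 [a0A t0 e0 f0]]]] := @ex_attached 2 isT.
have [a1 [z1 [E1 [a1A t1 e1 f1]]]] := @ex_attached 3 isT.
apply: (@no_branches k.-1); first by move: k3; clear; lia.
exact: (@two_branches_trees _ _ _ _ _ _ _ vNA k.-1 1 _ _ _ _ _ _ isT a0A a1A t0 t1 e0 e1 f0 f1).
Qed.

End Levels.

(** * Connector's strategy *)

Section Winning.
Variables (V : finType) (u : V) (G : {set {set V}}) (col : V -> nat) (k m L : nat).
Implicit Types (B C : {set {set V}}).
Hypothesis k3 : 3 <= k.
Hypothesis L0 : 0 < L.
Hypothesis kLm : 100 * k * L <= m.
Hypothesis VL : #|V| < 2 ^ L.
Hypothesis Gexp : expander col k m G.

Import Order.TTheory GRing.Theory Num.Theory.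

Let m300 : 300 <= m. Proof. by move: k3 L0 kLm; clear; nia. Qed.
Let km : 8 * k <= m. Proof. by move: L0 kLm; clear; nia. Qed.
Let q0 : 0 < 4 * k. Proof. by move: k3; clear; lia. Qed.
Let M1 : 0 < m ^ k. Proof. by rewrite expn_gt0; move: m300; lia. Qed.

Local Notation wt := (base (4 * k)).

(** The base is taken for q = 4k: in the k rounds of one phase Breaker claims at most 2k edges,
    raising degrees by at most 4k in total. *)
Definition potential (B0 C B : {set {set V}}) : rat :=
  (\sum_(x in ~: verts u C) wt ^+ degree (B :\: B0) x)%R.

(** The invariant between phases. Each phase adds at most 2k Breaker edges and at least one vertex
    to Connector's graph, whence the ratio 2k. *)
Definition steady B0 C B : Prop :=
  [/\ valid u G C B, B0 \subset B, #|B| <= 2 * k * #|verts u C|,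
      2 * m ^ k <= #|verts u C| & (potential B0 C B <= #|V|%:R)%R].

(** A larger degree would alone contribute 2^L > |V| to the potential, as 8kL = 2qL for q = 4k. *)
Lemma steady_degree B0 C B x : steady B0 C B -> x \notin verts u C ->
  degree (B :\: B0) x <= 8 * k * L.
Proof.
case=> _ _ _ _ pot xC; rewrite leqNgt; apply/negP=> big.
have b1 : (1 <= wt)%R by apply: base_ge1.
suff : (2 ^+ L <= #|V|%:R :> rat)%R by rewrite -natrX ler_nat leqNgt VL.
apply: le_trans (le_trans _ pot); first exact: base_exp_ge q0 L.
rewrite /potential (bigD1 x) ?inE //=; last by move: xC; rewrite !inE.
apply: le_trans (_ : (wt ^+ degree (B :\: B0) x <= _)%R); last first.
  by rewrite lerDl sumr_ge0 // => y _; apply/exprn_ge0/(le_trans _ b1).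
apply: ler_weXn2l => //; move: big; clear; lia.
Qed.

Lemma steady_force v B0 C B : #|B0| <= 4 * m ^ k -> steady B0 C B -> v \notin verts u C ->
  force u G (fun C' _ => v \in verts u C') k C B.
Proof.
move=> B0m st vC; apply: contrapT => slow; have [vCB B0B BA mA _] := st.
apply: (@slow_contra V u v G B0 C B col k m (8 * k * L)) => //.
  by move: kLm; clear; lia.
by move=> x; apply: steady_degree st.
Qed.

Lemma steady_step v B0 C B C' B' : steady B0 C B ->
  v \notin verts u C -> (forall x, x \notin verts u C -> degree (B :\: B0) x <= degree (B :\: B0) v) ->
  v \in verts u C' -> valid u G C' B' -> C \subset C' -> B \subset B' -> #|B' :\: B| <= 2 * k ->
  steady B0 C' B'.
Proof.
case=> vCB B0B BA mA pot vC vmax vC' vCB' CC' BB' cB.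
have AA' : verts u C \proper verts u C'.
  by apply/properP; split; [exact: vertsS | exists v].
have cA := proper_card AA'.
split=> //.
- exact: subset_trans BB'.
- have : #|B'| = #|B| + #|B' :\: B| by rewrite -(cardsID B B') (setIidPr BB').
  move: BA cB cA; move: #|B'| #|B| #|_ :\: _| #|_| #|_|; clear; nia.
- exact: leq_trans mA (ltnW cA).
apply: le_trans pot; rewrite /potential.
have b1 : (1 <= wt)%R by apply: base_ge1.
apply: le_trans (_ : (\sum_(x in ~: verts u C')
    wt ^+ (degree (B :\: B0) x + degree (B' :\: B) x) <= _)%R).
  by apply: ler_sum => x _; apply: ler_weXn2l => //; apply: degreeD.
apply: (@potential_step _ _ q0 _ _ _ _ v).
- by rewrite inE.
- by move=> x; rewrite inE => /vmax.
- by rewrite subsetD1 in_setC vC' andbT setCS proper_sub.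
- rewrite sum_degree; last first.
    have [_ BG' _ _] := vCB'; apply: subset_trans (expander_complete Gexp).
    exact: subset_trans (subsetDl _ _) BG'.
  by move: cB; clear; lia.
Qed.

Lemma steady_spans j B0 C B : #|B0| <= 4 * m ^ k -> #|~: verts u C| <= j ->
  steady B0 C B -> force u G (fun C _ => [set: V] \subset verts u C) (k * j) C B.
Proof.
move=> B0m; elim: j C B => [|j IH] C B cj st.
  move: cj; rewrite leqn0 cards_eq0 => /eqP A0.
  by apply: force_now; rewrite -(setCK (verts u C)) A0 finset.setC0.
have [A0|[v vC]] := set_0Vmem (~: verts u C).
  by apply: force_now; rewrite -(setCK (verts u C)) A0 finset.setC0.
pose w := [arg max_(x > v in ~: verts u C) degree (B :\: B0) x].
have [wC wmax] : w \in ~: verts u C /\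
    forall x, x \in ~: verts u C -> degree (B :\: B0) x <= degree (B :\: B0) w.
  by rewrite /w; case: arg_maxnP => // x xC xmax; split=> // y /xmax.
rewrite inE in wC; rewrite mulnS.
have [vCB _ _ _ _] := st.
apply: force_trans (force_track vCB (steady_force B0m st wC)) _.
move=> C' B' [wC' vCB' CC' BB' cB]; apply: IH; last first.
  by apply: (steady_step st wC _ wC') => // x xC; apply: wmax; rewrite inE.
rewrite -ltnS; apply: leq_trans cj; apply: proper_card; apply/properP; split.
  by rewrite setCS vertsS.
by exists w; rewrite in_setC ?wC'.
Qed.

(** One new leaf of a star at [u] per round. The star and the Breaker neighbours of [u] together
    stay below the 2m^(k+1) vertices that expansion from [u] can avoid. *)
Lemma opening i : i <= 2 * m ^ k ->
  force u G (fun C B => [/\ valid u G C B, #|verts u C| = i.+1 & #|B| <= 2 * i])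
    i finset.set0 finset.set0.
Proof.
elim: i => [_|i IH im].
  split; last by rewrite cards0.
    by split; rewrite ?disjoints_subset ?sub0set // => x /bigcupP[e]; rewrite inE.
  by rewrite /verts /finset.cover big_set0 finset.setU0 cards1.
set P := (X in force _ _ X); rewrite -addn1.
apply: force_trans (IH (ltnW im)) _ => C B [vCB cA cB].
have [CG BG CB rC] := vCB.
have [|||x [_ xY /mem_nbrs[y /set1P-> uxG]]] :=
  @expander_single _ _ _ _ _ Gexp [set u] _ 0 (verts u C :|: nbrs B [set u]).
- by rewrite cards1 M1.
- by rewrite expn_gt0.
- apply: leq_trans (leq_card_setU _ _) _; rewrite cA cards1 expnS.
  have : #|nbrs B [set u]| <= 2 * i.
    apply: leq_trans (card_nbrs _ _) _; rewrite big_set1; apply: leq_trans cB.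
    by apply: subset_leq_card; apply/subsetP=> e; rewrite inE => /andP[].
  move: im M1 m300; move: (m ^ k) #|_| => M a; clear; nia.
move: xY; rewrite in_setU negb_or => /andP[xC xN].
have uC : u \in verts u C by rewrite !inE eqxx.
right; exists [set [set u; x]]; split; rewrite ?cards1 //.
- rewrite sub1set mem_avail uxG /=; apply/andP; split.
    by apply: contra xC => eC; apply: mem_verts_edge eC _; rewrite set22.
  by apply: contra xN => uxB; rewrite inE; apply/existsP; exists u; rewrite set11.
- by rewrite setUC; apply: rootedU1.
move=> Q Qf Q2; have rM : rooted u (C :|: [set [set u; x]]) by rewrite setUC; apply: rootedU1.
split.
- apply: (valid_step vCB) => //; rewrite sub1set mem_avail uxG /=; apply/andP; split.
    by apply: contra xC => eC; apply: mem_verts_edge eC _; rewrite set22.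
  by apply: contra xN => uxB; rewrite inE; apply/existsP; exists u; rewrite set11.
- by rewrite setUC vertsU1 // cardsU1 xC cA.
- by apply: leq_trans (leq_card_setU _ _) _; rewrite mulnS addnC leq_add.
Qed.

Lemma expander_wins : connector_wins 2 2 G.
Proof.
apply: (@force_connector_wins _ u _ (2 * m ^ k + k * #|V|)).
apply: force_trans (opening (leqnn _)) _ => C B [vCB cA cB].
apply: (@steady_spans _ B); [by move: cB; clear; lia | exact: max_card |].
split=> //.
- by rewrite cA; move: cB k3; move: (m ^ k) #|B|; clear; nia.
- by rewrite cA.
(* With all opening edges discounted, every vertex starts with weight 1. *)
rewrite /potential setDv.
rewrite (eq_bigr (fun=> 1%R)) => [|x _]; last first.
  rewrite /degree (_ : [set e in _ | _] = finset.set0) ?cards0 ?expr0 //.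
  by apply/setP=> e; rewrite !inE.
by rewrite sumr_const ler_nat max_card.
Qed.

End Winning.

(** * Avoidance probabilities in G(n,p) *)

Import Order.TTheory GRing.Theory Num.Theory.

Section Gnp.
Local Open Scope ring_scope.
Variables (R : realType) (n : nat) (p : R).
Hypothesis p01 : 0 <= p <= 1.
Local Notation V := 'I_n.
Local Notation pr := (@gnp_prob R n p).
Implicit Types (G U : {set {set V}}) (P : {set {set V}} -> Prop).

Definition gnp_weight G : R := \prod_(e in complete V) (if e \in G then p else 1 - p).

Let p0 : 0 <= p. Proof. by case/andP: p01. Qed.
Let p1 : 0 <= 1 - p. Proof. by rewrite subr_ge0; case/andP: p01. Qed.

Lemma gnp_weight_ge0 G : 0 <= gnp_weight G.
Proof. by apply: prodr_ge0 => e _; case: ifP. Qed.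

Lemma gnp_probE P :
  pr P = \sum_(G : {set {set V}} | G \subset complete V) (`[< P G >]%:R * gnp_weight G).
Proof.
rewrite /gnp_prob big_mkcondr; apply: eq_bigr => G _.
by case: `[< P G >]; rewrite ?mul1r ?mul0r.
Qed.

(** Distributivity; outside [D] the factor is 0 for a present edge and 1 for an absent one, which
    restricts the sum to subsets of [D]. *)
Lemma sum_subsets_prod (D : {set {set V}}) (f g : {set V} -> R) :
  \sum_(G : {set {set V}} | G \subset D) \prod_(e in D) (if e \in G then f e else g e)
  = \prod_(e in D) (f e + g e).
Proof.
rewrite [RHS]big_mkcond.
rewrite (eq_bigr (fun e => (if e \in D then f e else 0) + (if e \in D then g e else 1))); last first.
  by move=> e _; case: ifP => // _; rewrite add0r.
rewrite (@bigA_distr R 0 1 *%R +%R) [RHS]big_mkcond [LHS]big_mkcond; apply: eq_bigr => G _ /=.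
case: ifPn => [GD|/subsetPn[e eG eD]]; last first.
  by rewrite (bigD1 e) //= eG (negPf eD) mul0r.
rewrite big_mkcond; apply: eq_bigr => e _; case: (boolP (e \in D)) => // eD.
by rewrite (contraNF (subsetP GD e)).
Qed.

(** Setting the weight of a present edge of [U] to 0 turns the sum into a product with factors 1-p
    on [U] and 1 elsewhere. *)
Lemma gnp_prob_avoid U : U \subset complete V ->
  pr (fun G => [disjoint U & G]) = (1 - p) ^+ #|U|.
Proof.
move=> /setIidPr Uc; rewrite gnp_probE.
rewrite (eq_bigr (fun G => \prod_(e in complete V)
    (if e \in G then (if e \in U then 0 else p) else 1 - p))) => [|G Gc]; last first.
  rewrite asboolb; case: (boolP [disjoint U & G]) => [UG|].
    rewrite mul1r; apply: eq_bigr => e _; case: ifP => // eG.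
    by rewrite (disjointFl UG eG).
  rewrite -setI_eq0 => /set0Pn[e]; rewrite inE => /andP[eU eG].
  rewrite mul0r (bigD1 e) /=; last by apply: (subsetP Gc).
  by rewrite eG eU mul0r.
rewrite sum_subsets_prod (big_setID U) /= Uc.
rewrite [X in X * _](eq_bigr (fun=> 1 - p)) => [|e ->]; last by rewrite add0r.
rewrite [X in _ * X]big1 ?mulr1 ?prodr_const // => e; rewrite inE => /andP[/negPf-> _].
by rewrite addrC subrK.
Qed.

Lemma gnp_prob_mono P Q :
  (forall G, G \subset complete V -> P G -> Q G) -> pr P <= pr Q.
Proof.
move=> PQ; rewrite !gnp_probE; apply: ler_sum => G Gc.
apply: ler_wpM2r; first exact: gnp_weight_ge0.
rewrite ler_nat; case: (asboolP (P G)) => // /(PQ _ Gc) QG.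
by case: (asboolP (Q G)).
Qed.

Lemma gnp_probT : pr (fun=> True) = 1.
Proof.
rewrite gnp_probE (eq_bigr gnp_weight) => [|G _]; last by rewrite asboolT ?mul1r.
by rewrite sum_subsets_prod big1 // => e _; rewrite addrC subrK.
Qed.

Lemma gnp_prob_le1 P : pr P <= 1.
Proof. by rewrite -gnp_probT; apply: gnp_prob_mono. Qed.

Lemma gnp_probC P : pr P = 1 - pr (fun G => ~ P G).
Proof.
rewrite -gnp_probT !gnp_probE -sumrB; apply: eq_bigr => G _.
rewrite -mulrBl (asboolT I) asbool_neg; congr (_ * _).
by case: `[< _ >]; rewrite /= ?subr0 ?subrr.
Qed.

Lemma gnp_probU P Q : pr (fun G => P G \/ Q G) <= pr P + pr Q.
Proof.
rewrite !gnp_probE -big_split /=; apply: ler_sum => G _.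
rewrite -mulrDl; apply: ler_wpM2r; first exact: gnp_weight_ge0.
rewrite asbool_or -natrD ler_nat; by case: `[< P G >]; case: `[< Q G >].
Qed.

Lemma gnp_prob_exists (T : finType) (Q : pred T) (P : T -> {set {set V}} -> Prop) c :
  (forall x, Q x -> pr (P x) <= c) ->
  pr (fun G => exists2 x, Q x & P x G) <= #|Q|%:R * c.
Proof.
move=> Pc; rewrite mulr_natl -sumr_const.
apply: le_trans (ler_sum _ (fun x (Qx : x \in Q) => Pc x Qx)).
under [leRHS]eq_bigr do rewrite gnp_probE.
rewrite gnp_probE exchange_big /=; apply: ler_sum => G _.
rewrite -mulr_suml; apply: ler_wpM2r; first exact: gnp_weight_ge0.
case: asboolP => [[x Qx PxG]|_]; last by apply: sumr_ge0 => x _; exact: ler0n.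
rewrite (bigD1 x) //= asboolT // lerDl; apply: sumr_ge0 => y _; exact: ler0n.
Qed.

(** Independence over [i] via inclusion-exclusion: the indicator of each disjunction is a signed sum
    of three avoidance indicators. Expanding the product leaves only events of avoiding a disjoint
    union. *)
Lemma gnp_prob_either (I : finType) (S0 S1 : I -> {set {set V}}) :
  (forall i, S0 i :|: S1 i \subset complete V) -> (forall i, [disjoint S0 i & S1 i]) ->
  (forall i j, i != j -> [disjoint S0 i :|: S1 i & S0 j :|: S1 j]) ->
  pr (fun G => forall i, [disjoint S0 i & G] \/ [disjoint S1 i & G])
  = \prod_i ((1 - p) ^+ #|S0 i| + (1 - p) ^+ #|S1 i| - (1 - p) ^+ (#|S0 i| + #|S1 i|)).
Proof.
move=> Sc Sd SD.
(* The third term, the union with sign -1, is encoded as the default value of [nth]. *)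
pose T i (j : 'I_3) := nth (S0 i :|: S1 i) [:: S0 i; S1 i] j.
pose c (j : 'I_3) : R := nth (-1) [:: 1; 1] j.
have TS i j : T i j \subset S0 i :|: S1 i.
  by case: j => -[|[|j]] jlt; rewrite /T /= ?nth_nil ?subsetUl ?subsetUr.
have sum3 (f : 'I_3 -> R) : \sum_j f j = f ord0 + f (lift ord0 ord0) + f ord_max.
  rewrite !big_ord_recl big_ord0 addr0 addrA; congr (_ + f _); exact: val_inj.
transitivity (\prod_i \sum_j c j * (1 - p) ^+ #|T i j|); last first.
  apply: eq_bigr => i _; rewrite sum3 /T /c /= !mul1r mulN1r cardsU.
  by rewrite (disjoint_setI0 (Sd i)) cards0 subn0.
rewrite bigA_distr_bigA gnp_probE.
transitivity (\sum_(G : {set {set V}} | G \subset complete V)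
    \sum_(f : {ffun I -> 'I_3}) (\prod_i c (f i)) *
      (`[< [disjoint \bigcup_i T i (f i) & G] >]%:R * gnp_weight G)).
  apply: eq_bigr => G _.
  transitivity ((\prod_i \sum_j c j * [disjoint T i j & G]%:R) * gnp_weight G).
    congr (_ * _); rewrite (eq_bigr (fun i => ([disjoint S0 i & G] || [disjoint S1 i & G])%:R)).
      rewrite -natr_prod; congr (_%:R).
      case: asboolP => [al|/existsNP[i /not_orP[/negP n0 /negP n1]]]; last first.
        by rewrite (bigD1 i) //= (negPf n0) (negPf n1) mul0n.
      by rewrite big1 // => i _; case: (al i) => ->; rewrite ?orbT.
    move=> i _; rewrite sum3 /T /c /= !mul1r mulN1r -!setI_eq0 setIUl setU_eq0.
    by case: (_ == _); case: (_ == _); rewrite /= ?subr0 ?addr0 ?add0r ?addrK.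
  rewrite bigA_distr_bigA mulr_suml; apply: eq_bigr => f _.
  rewrite big_split /= -mulrA; congr (_ * (_ * _)).
  rewrite -natr_prod asboolb; congr (_%:R).
  case: (boolP [disjoint _ & G]) => [d|].
    rewrite big1 // => i _; rewrite (disjointWl _ d) //; exact: (bigcup_sup i).
  rewrite -setI_eq0 => /set0Pn[e]; rewrite inE => /andP[/bigcupP[i _ ei] eG].
  rewrite (bigD1 i) //= (_ : [disjoint _ & _] = false) ?mul0n //.
  by apply/negP=> d; rewrite (disjointFr d ei) in eG.
rewrite exchange_big; apply: eq_bigr => f _ /=.
rewrite -mulr_sumr -gnp_probE gnp_prob_avoid; last first.
  by apply/bigcupsP => i _; apply: subset_trans (TS i _) (Sc i).
rewrite [RHS]big_split /= -prodr_const partition_disjoint_bigcup.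
  by congr (_ * _); apply: eq_bigr => i _; rewrite prodr_const.
move=> i j /SD; apply: disjointW; exact: TS.
Qed.

(** * Stars and missing edges *)

Implicit Types (X Z : {set V}) (x y z : V).

Definition star (X : {set V}) (y : V) := [set [set x; y] | x in X].

Lemma card_star X y : #|star X y| = #|X|.
Proof. by apply: card_imset => a b; rewrite ![[set _; y]]finset.setUC; apply: set2_inj. Qed.

Lemma star_complete X y : y \notin X -> star X y \subset complete V.
Proof.
move=> yX; apply/subsetP=> e /imsetP[x xX ->]; rewrite inE cards2.
by rewrite (_ : x != y) //; apply: contraNneq yX => <-.
Qed.

Lemma star_disjoint X (X' : {set V}) y (y' : V) : y != y' -> y \notin X' -> [disjoint star X y & star X' y'].
Proof.
move=> yy' yX'; rewrite disjoints_subset; apply/subsetP => e /imsetP[x xX ->].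
rewrite inE; apply/imsetP=> -[x' x'X' /setP /(_ y)].
rewrite !inE eqxx orbT (negPf yy') orbF => /esym/eqP yx'.
by rewrite yx' x'X' in yX'.
Qed.

Lemma star_disjoint_same X (X' : {set V}) y : [disjoint X & X'] -> [disjoint star X y & star X' y].
Proof.
move=> XX'; rewrite disjoints_subset; apply/subsetP => e /imsetP[x xX ->].
rewrite inE; apply/imsetP=> -[x' x'X']; rewrite ![[set _; y]]finset.setUC => /set2_inj xx'.
by rewrite -xx' (disjointFr XX' xX) in x'X'.
Qed.

Lemma nbrs_star G X y : (y \in nbrs G X) = ~~ [disjoint star X y & G].
Proof.
rewrite -setI_eq0 inE; apply/existsP/set0Pn => [[x /andP[xX xyG]]|[e]].
  by exists [set x; y]; rewrite inE xyG andbT; apply/imsetP; exists x.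
by rewrite inE => /andP[/imsetP[x xX ->] xyG]; exists x; rewrite xX.
Qed.

(** The stars from [X] to the vertices of [Z] are disjoint, and all their edges must be absent. *)
Lemma gnp_prob_no_edge (X Z : {set V}) : [disjoint X & Z] ->
  pr (fun G => forall z, z \in Z -> z \notin nbrs G X) <= (1 - p) ^+ (#|X| * #|Z|).
Proof.
move=> XZ; pose S z := if z \in Z then star X z else finset.set0.
have zX z : z \in Z -> z \notin X by move=> zZ; rewrite (disjointFl XZ).
have -> : (#|X| * #|Z|)%N = #|\bigcup_z S z|.
  rewrite -[RHS]sum1_card partition_disjoint_bigcup => [|z z' zz'].
    rewrite mulnC -sum_nat_const [LHS]big_mkcond; apply: eq_bigr => z _; rewrite sum1_card /S.
    by case: ifP => _; rewrite ?card_star ?cards0.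
  rewrite /S; case: ifP => zZ; last by rewrite disjoints_subset sub0set.
  case: ifP => z'Z; last by rewrite disjoint_sym disjoints_subset sub0set.
  exact: star_disjoint (zX _ _).
rewrite -gnp_prob_avoid; last first.
  by apply/bigcupsP => z _; rewrite /S; case: ifP => zZ; rewrite ?sub0set ?star_complete ?zX.
apply: gnp_prob_mono => G _ none.
rewrite disjoints_subset; apply/bigcupsP => z _; rewrite -disjoints_subset /S; case: ifP => zZ.
  by have := none z zZ; rewrite nbrs_star negbK.
by rewrite disjoints_subset sub0set.
Qed.

(** A given [z] is a common neighbour with probability (1 - (1-p)^s)^2, independently for different
    [z] because their stars are disjoint. *)
Lemma gnp_prob_no_common (X0 X1 Z : {set V}) s : [disjoint X0 & X1] ->
  [disjoint X0 & Z] -> [disjoint X1 & Z] -> #|X0| = s -> #|X1| = s ->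
  pr (fun G => forall z, z \in Z -> z \notin nbrs G X0 \/ z \notin nbrs G X1)
    <= (1 - (1 - (1 - p) ^+ s) ^+ 2) ^+ #|Z|.
Proof.
move=> X01 X0Z X1Z c0 c1.
pose S (X : {set V}) z := if z \in Z then star X z else finset.set0.
have zX0 z : z \in Z -> z \notin X0 by move=> zZ; rewrite (disjointFl X0Z).
have zX1 z : z \in Z -> z \notin X1 by move=> zZ; rewrite (disjointFl X1Z).
have -> : (1 - (1 - (1 - p) ^+ s) ^+ 2) ^+ #|Z|
    = pr (fun G => forall z, [disjoint S X0 z & G] \/ [disjoint S X1 z & G]).
  rewrite gnp_prob_either => [|z|z|z z' zz'].
  - rewrite -prodr_const big_mkcond; apply: eq_bigr => z _; rewrite /S; case: ifP => _.
      by rewrite !card_star c0 c1 exprD; ring.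
    by rewrite !cards0 expr0 addrK.
  - by rewrite /S; case: ifP => zZ; rewrite ?finset.setU0 ?sub0set // subUset !star_complete ?zX0 ?zX1.
  - rewrite /S; case: ifP => _; first exact: star_disjoint_same.
    by rewrite disjoints_subset sub0set.
  - rewrite /S; case: ifP => zZ; last by rewrite finset.setU0 disjoints_subset sub0set.
    case: ifP => z'Z; last by rewrite finset.setU0 disjoint_sym disjoints_subset sub0set.
    rewrite disjoints_subset subUset -!disjoints_subset !(disjoint_sym (star _ z)).
    rewrite !disjoints_subset !subUset -!disjoints_subset.
    by rewrite !star_disjoint ?zX0 ?zX1 // eq_sym.
apply: gnp_prob_mono => G _ none z; rewrite /S; case: ifP => zZ.
  by have := none z zZ; rewrite !nbrs_star !negbK.
by left; rewrite disjoints_subset sub0set.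
Qed.

End Gnp.

(** * G(n,p) is an expander *)

Lemma superset_of_card (T : finType) (X : {set T}) j : #|X| <= j <= #|T| ->
  exists2 Y : {set T}, X \subset Y & #|Y| = j.
Proof.
case/andP=> Xj jT; have [|Z ZX Zc] := @subset_of_card _ (~: X) (#|T| - j).
  by move: (cardsC X); lia.
exists (~: Z); first by rewrite -[X]setCK setCS.
by move: (cardsC Z) Zc jT; clear; lia.
Qed.

Lemma bin_le_exp n a : 'C(n, a) <= n ^ a.
Proof.
apply: leq_trans (_ : n ^_ a <= _); first by rewrite -bin_ffact leq_pmulr ?fact_gt0.
elim: a => // a IH; rewrite ffactnSr expnSr; apply: leq_mul => //; exact: leq_subr.
Qed.

Section ColourClasses.
Variables (n c : nat).
Hypothesis c0 : 0 < c.

Definition zone i (W : {set 'I_n}) := [set x : 'I_n | x %% c == i] :\: W.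

Lemma card_zone i (W : {set 'I_n}) : i < c -> n %/ c - #|W| <= #|zone i W|.
Proof.
move=> ic; rewrite cardsD; apply: leq_sub (subset_leq_card (subsetIr _ _)).
have lt (j : 'I_(n %/ c)) : j * c + i < n.
  apply: leq_trans (leq_trunc_div n c); apply: leq_trans (_ : j.+1 * c <= _).
    by rewrite mulSn addnC ltn_add2r.
  by rewrite leq_pmul2r.
pose f j := Ordinal (lt j).
have fi : injective f.
  move=> j j' /(congr1 val) /= /addIn /eqP; rewrite eqn_pmul2r // => /eqP; exact: val_inj.
rewrite -[X in X <= _]card_ord -(card_imset _ fi); apply/subset_leq_card/subsetP => x.
by case/imsetP=> j _ ->; rewrite inE /= modnMDl modn_small.
Qed.

End ColourClasses.

Section GnpExpander.
Local Open Scope ring_scope.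
Variables (R : realType) (n : nat) (p : R) (k m L : nat).
Hypothesis p01 : 0 <= p <= 1.
Local Notation V := 'I_n.
Local Notation pr := (@gnp_prob R n p).
Local Notation M := (m ^ (k.*2 - 2))%N.
Local Notation c := (2 ^ k.+1)%N.
Hypothesis k3 : (3 <= k)%N.
Hypothesis L0 : (0 < L)%N.
Hypothesis cLm : (16 * c * L <= m)%N.
Hypothesis mn : (m ^ (3 * k) <= n)%N.
Hypothesis nL : (n <= 2 ^ L)%N.
Hypothesis Mp : M%:R^-1 <= p.

Let m0 : (0 < m)%N.
Proof. by apply: leq_trans cLm; rewrite !muln_gt0 expn_gt0. Qed.

Let M0 : 0 < M%:R :> R. Proof. by rewrite ltr0n expn_gt0 m0. Qed.

Lemma natr_expR_le j : (2 ^ j)%:R <= expR j%:R :> R.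
Proof.
rewrite -[j%:R]mulr1 expRM_natl natrX; apply: lerXn2r; rewrite ?nnegrE ?expR_ge0 //.
by have := expR_ge1Dx (1 : R); lra.
Qed.

Lemma expr_1Bp_le N j : (M * j <= N)%N -> (1 - p) ^+ N <= expR (- j%:R).
Proof.
move=> le; have /andP[p0 p1] := p01.
apply: le_trans (_ : expR (- p) ^+ N <= _).
  by apply: lerXn2r; rewrite ?nnegrE ?expR_ge0 ?subr_ge0 //; apply: expR_ge1Dx.
rewrite -expRM_natl ler_expR mulrN lerN2; apply: le_trans (_ : N%:R * M%:R^-1 <= _); last first.
  by apply: ler_wpM2l.
by rewrite ler_pdivlMr // -natrM ler_nat mulnC.
Qed.

(** For x = 1/M and sx <= 1 one has (1-x)^s <= 1 - sx/2, so the bracket is at most 1 - (s/2M)^2 <=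
    exp(-(s/2M)^2). *)
Lemma expr_joint_le s N j : (s <= M)%N -> (4 * M ^ 2 * j <= s ^ 2 * N)%N ->
  (1 - (1 - (1 - p) ^+ s) ^+ 2) ^+ N <= expR (- j%:R).
Proof.
move=> sM le; have /andP[p0 p1] := p01.
set x : R := M%:R^-1; have x0 : 0 < x by rewrite invr_gt0.
have x1 : x <= 1 by apply: le_trans p1.
have sx : s%:R * x / 2 <= 1 - (1 - p) ^+ s.
  rewrite lerBrDr addrC -lerBrDr; apply: le_trans (_ : (1 - x) ^+ s <= _).
    by apply: lerXn2r; rewrite ?nnegrE ?subr_ge0 // lerD2l lerN2.
  have : s%:R * x <= 1 by rewrite ler_pdivrMr // mul1r ler_nat.
  elim: (s) => [|i IH]; first by rewrite expr0 !mul0r subr0.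
  rewrite -[i.+1%:R]natr1 => ix; rewrite exprS.
  have i1 : i%:R * x <= 1 by apply: le_trans ix; rewrite ler_pM2r // lerDl.
  apply: le_trans (ler_wpM2l _ (IH i1)) _; first by rewrite subr_ge0.
  have : i%:R * x * x <= x by apply: ler_piMl => //; apply: ltW.
  lra.
set y := 1 - (1 - p) ^+ s in sx *.
have y1 : y <= 1 by rewrite gerBl exprn_ge0 ?subr_ge0.
have sx0 : 0 <= s%:R * x / 2 by rewrite divr_ge0 ?mulr_ge0 ?ler0n ?(ltW x0).
have y0 := le_trans sx0 sx.
have sx2 : (s%:R * x / 2) ^+ 2 <= y ^+ 2 by apply: lerXn2r.
apply: le_trans (_ : expR (- (s%:R * x / 2) ^+ 2) ^+ N <= _).
  apply: lerXn2r; rewrite ?nnegrE ?expR_ge0 //; first by rewrite subr_ge0 exprn_ile1.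
  by apply: le_trans (expR_ge1Dx _); lra.
rewrite -expRM_natl ler_expR mulrN lerN2.
have -> : (s%:R * x / 2) ^+ 2 = (s ^ 2)%:R / (4 * M ^ 2)%:R.
  rewrite /x natrM !(natrX _ _ 2); field; exact: lt0r_neq0.
rewrite mulrA ler_pdivlMr ?ltr0n ?muln_gt0 ?expn_gt0 ?m0 // -!natrM ler_nat.
by rewrite mulnC (mulnC N).
Qed.

Lemma gnp_prob_exists_nat N (P : nat -> {set {set V}} -> Prop) e :
  (forall i, (i < N)%N -> pr (P i) <= e) ->
  pr (fun G => exists i, (i < N)%N /\ P i G) <= N%:R * e.
Proof.
move=> Pe; rewrite -[N in N%:R]card_ord.
apply: le_trans (@gnp_prob_exists _ _ _ p01 _ xpredT (fun i : 'I_N => P i) _ (fun i _ => Pe i (ltn_ord i))).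
by apply: gnp_prob_mono => // G _ [i [iN PG]]; exists (Ordinal iN).
Qed.

(** Union bound over at most n^a <= 2^(La) <= e^(La) sets: choosing a set of size [a] costs La in
    the exponent. *)
Lemma gnp_prob_exists_set a (P : {set V} -> {set {set V}} -> Prop) (e : R) : 0 <= e ->
  (forall X : {set V}, #|X| = a -> pr (P X) <= e) ->
  pr (fun G => exists X : {set V}, #|X| = a /\ P X G) <= expR (L * a)%:R * e.
Proof.
move=> e0 Pe; apply: le_trans (_ : #|[pred X : {set V} | #|X| == a]|%:R * e <= _); last first.
  apply: ler_wpM2r => //; apply: le_trans (natr_expR_le _); rewrite ler_nat expnM.
  have -> : #|[pred X : {set V} | #|X| == a]| = 'C(n, a).
    by rewrite -[n in RHS]card_ord -card_draws cardsE.
  apply: leq_trans (bin_le_exp n a) _.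
  by case: a {Pe} => // a; rewrite leq_exp2r.
apply: le_trans (@gnp_prob_exists _ _ _ p01 _ _ P _ (fun X Xa => Pe X (eqP Xa))).
by apply: gnp_prob_mono => // G _ [X [/eqP Xa PG]]; exists X.
Qed.


Local Notation zone := (zone c).

(** Each colour class has at least 16 L m^(3k-1) vertices, and [W] removes at most half of that
    number. *)
Let zone_big i (W : {set V}) : (i < c)%N -> (#|W| <= 8 * L * m ^ (3 * k - 1))%N ->
  (8 * L * m ^ (3 * k - 1) <= #|zone i W|)%N.
Proof.
move=> ic Wm; apply: leq_trans (card_zone _ W ic); last by rewrite expn_gt0.
have : (16 * L * m ^ (3 * k - 1) <= n %/ c)%N.
  rewrite leq_divRL ?expn_gt0 //; apply: leq_trans mn.
  have e3 : (3 * k = (3 * k - 1).+1)%N by move: k3; clear; lia.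
  rewrite [X in (_ <= m ^ X)%N]e3 (expnS m) (mulnAC (16 * L)%N) leq_mul2r.
  by rewrite (mulnAC 16) cLm orbT.
by move: Wm; move: (m ^ _)%N (n %/ c)%N #|W|; clear; nia.
Qed.

Let small a : (0 < a <= m ^ k)%N -> (a + 2 * m ^ k.+1 * a <= 8 * L * m ^ (3 * k - 1))%N.
Proof.
case/andP=> _ ak; have y0 : (0 < m ^ k.+1)%N by rewrite expn_gt0 m0.
have za : (m ^ k.+1 * a <= m ^ (3 * k - 1))%N.
  apply: leq_trans (leq_mul (leqnn _) ak) _.
  by rewrite -expnD leq_pexp2l //; move: k3; clear; lia.
have zL : (m ^ (3 * k - 1) <= L * m ^ (3 * k - 1))%N by rewrite leq_pmull.
have ya : (a <= m ^ k.+1 * a)%N by rewrite leq_pmull.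
by rewrite -!mulnA; move: za zL ya; clear; lia.
Qed.

(** The excluded set is padded to its maximal size, so that the union bound runs over sets of one
    size. [X] is excluded as well, to keep its stars free of loops. *)
Definition single_fails G : Prop :=
  exists i, (i < c)%N /\ exists a, (a < m ^ k)%N /\
  exists X : {set V}, #|X| = a.+1 /\ exists Y : {set V}, #|Y| = (2 * m ^ k.+1 * a.+1)%N /\
  forall z, z \in zone i (X :|: Y) -> z \notin nbrs G X.

Definition joint_fails G : Prop :=
  exists i, (i < c)%N /\ exists s, (s < M.+1)%N /\
  exists X0 : {set V}, #|X0| = s /\ exists X1 : {set V}, #|X1| = s /\
  exists Y : {set V}, #|Y| = (m ^ 2 * s)%N /\
  [/\ [disjoint X0 & X1], (m ^ k.+1 <= s)%N
    & forall z, z \in zone i (X0 :|: X1 :|: Y) -> z \notin nbrs G X0 \/ z \notin nbrs G X1].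

Definition dense_fails G : Prop :=
  exists X : {set V}, #|X| = (m ^ (k.*2 - 1))%N /\
  exists Z : {set V}, #|Z| = (m ^ (k.*2 - 1))%N /\
  ([disjoint X & Z] /\ forall z, z \in Z -> z \notin nbrs G X).

Lemma expander_or_fails (G : {set {set V}}) : G \subset complete V ->
  ~ single_fails G -> ~ joint_fails G -> ~ dense_fails G ->
  expander (fun x : V => x %% c)%N k m G.
Proof.
have m1 : (1 <= m)%N by [].
have nV : #|V| = n by rewrite card_ord.
move=> Gc n1 n2 n3; split=> //.
- move=> X /andP[X0 Xm] i Y ic Yb; apply: contrapT => no; apply: n1.
  have [|Y' YY' cY'] := @superset_of_card _ Y (2 * m ^ k.+1 * #|X|)%N.
    rewrite Yb nV; apply: leq_trans mn.
    have : (2 * m ^ k.+1 * m ^ k <= m ^ (3 * k))%N.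
      apply: leq_trans (_ : m ^ 1 * m ^ k.+1 * m ^ k <= _)%N; last first.
        by rewrite -!expnD leq_pexp2l //; move: k3; clear; lia.
      rewrite -!mulnA leq_mul2r expn1; apply/orP; right.
      by apply: leq_trans cLm; move: L0 (expn_gt0 2 k.+1) => /=; move: c; clear; nia.
    by apply: leq_trans; rewrite leq_mul2l Xm orbT.
  exists i; split=> //; exists #|X|.-1; split; first by rewrite prednK.
  exists X; split; first by rewrite prednK.
  exists Y'; split; first by rewrite prednK.
  move=> z; rewrite inE in_setU negb_or inE => /andP[/andP[zX zY'] /eqP zi].
  apply/negP=> zn; apply: no; exists z; split=> //.
  by apply: contra zY' => /(subsetP YY').
- move=> X0 X1 dX c01 /andP[s1 s2] i Y ic Yb; apply: contrapT => no; apply: n2.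
  have [|Y' YY' cY'] := @superset_of_card _ Y (m ^ 2 * #|X0|)%N.
    rewrite Yb nV; apply: leq_trans mn; apply: leq_trans (leq_mul (leqnn _) s2) _.
    by rewrite -expnD leq_pexp2l //; move: k3; clear; lia.
  exists i; split=> //; exists #|X0|; split=> //; exists X0; split=> //; exists X1; split=> //.
  exists Y'; split=> //; split=> // z.
  rewrite inE !in_setU !negb_or inE => /andP[/andP[_ zY'] /eqP zi].
  have [z0|] := boolP (z \in nbrs G X0); last by left.
  right; apply/negP=> z1; apply: no; exists z; split=> //.
  by apply: contra zY' => /(subsetP YY').
- move=> X Z dXZ cX cZ; apply: contrapT => no; apply: n3.
  exists X; split=> //; exists Z; split=> //; split=> // z zZ.
  by apply/negP=> zn; apply: no; exists z.
Qed.

(** The missing edges contribute [j] to the exponent, since m^(3k-1) = M m^(k+1). This exceeds the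
    cost of choosing [X] and [Y] by at least Lm. *)
Lemma gnp_single_fails : pr single_fails <= c%:R * ((m ^ k)%:R * expR (- (L * m)%:R)).
Proof.
apply: gnp_prob_exists_nat => i ic; apply: gnp_prob_exists_nat => a am.
pose b := (2 * m ^ k.+1 * a.+1)%N; pose j := (8 * L * (a.+1 * m ^ k.+1))%N.
apply: le_trans (_ : expR (L * a.+1)%:R * (expR (L * b)%:R * expR (- j%:R)) <= _).
  apply: gnp_prob_exists_set => [|X cX]; first by rewrite mulr_ge0 ?expR_ge0.
  apply: gnp_prob_exists_set => [|Y cY]; first exact: expR_ge0.
  apply: le_trans (gnp_prob_no_edge p01 _) _.
    by rewrite disjoints_subset; apply/subsetP=> x xX; rewrite !inE xX.
  apply: expr_1Bp_le; rewrite cX.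
  apply: leq_trans (leq_mul (leqnn a.+1) (zone_big ic _)).
    rewrite /j; have -> : (m ^ (3 * k - 1) = M * m ^ k.+1)%N.
      by rewrite -expnD; congr (m ^ _)%N; move: k3; clear; lia.
    by move: M (m ^ k.+1)%N; clear; nia.
  by apply: leq_trans (leq_card_setU _ _) _; rewrite cX cY small.
rewrite -!expRD ler_expR addrA -natrD lerBlDr addrC lerBrDr -natrD ler_nat /b /j.
have : (m ^ 1 <= m ^ k.+1)%N by rewrite leq_pexp2l.
rewrite expn1; move: (m ^ k.+1)%N => y my; have : (a.+1 + 2 * y * a.+1 + m <= 8 * (a.+1 * y))%N.
  by move: my m0; clear; nia.
by move/(leq_mul (leqnn L)); clear; nia.
Qed.

Lemma gnp_joint_fails : pr joint_fails <= c%:R * (M.+1%:R * expR (- (L * m)%:R)).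
Proof.
apply: gnp_prob_exists_nat => i ic; apply: gnp_prob_exists_nat => s sM.
pose b := (m ^ 2 * s)%N; pose j := (2 * L * (m ^ 4 * s))%N.
(* For smaller [s] the event is impossible by definition. *)
have [s0|s0] := leqP (m ^ k.+1)%N s; last first.
  apply: le_trans (expR_ge0 _); rewrite gnp_probE big1 // => G _.
  rewrite asboolF ?mul0r // => -[X0 [_ [X1 [_ [Y [_ [_ le _]]]]]]].
  by [].
have s1 : (1 <= s)%N by apply: leq_trans s0; rewrite expn_gt0 m0.
apply: le_trans (_ : expR (L * s)%:R * (expR (L * s)%:R * (expR (L * b)%:R * expR (- j%:R))) <= _).
  apply: gnp_prob_exists_set => [|X0 c0]; first by rewrite !mulr_ge0 ?expR_ge0.
  apply: gnp_prob_exists_set => [|X1 c1]; first by rewrite mulr_ge0 ?expR_ge0.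
  apply: gnp_prob_exists_set => [|Y cY]; first exact: expR_ge0.
  have [dX|dX] := boolP [disjoint X0 & X1]; last first.
    apply: le_trans (expR_ge0 _); rewrite gnp_probE big1 // => G _.
    by rewrite asboolF ?mul0r // => -[].
  apply: le_trans (expr_joint_le sM _); last first.
    apply: leq_trans (leq_mul (leqnn _) (zone_big ic _)); last first.
      apply: leq_trans (leq_card_setU (X0 :|: X1) Y) _.
      apply: leq_trans (leq_add (leq_card_setU _ _) (leqnn _)) _.
      rewrite c0 c1 cY; have : (m ^ 2 * M <= m ^ (3 * k - 1))%N.
        by rewrite -expnD leq_pexp2l //; move: k3; clear; lia.
      have : (0 < m ^ 2)%N by rewrite expn_gt0 m0.
      move: sM L0; rewrite /b; move: M (m ^ 2)%N (m ^ (3 * k - 1))%N; clear; nia.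
    (* The lower bound on [s] enters here: M^2 m^4 = m^(4k) = m^(k+1) m^(3k-1). *)
    have : (M ^ 2 * m ^ 4 <= s * m ^ (3 * k - 1))%N.
      apply: leq_trans (leq_mul s0 (leqnn _)).
      by rewrite -expnM -!expnD leq_pexp2l //; move: k3; clear; lia.
    move/(leq_mul (leqnn (8 * L * s))); rewrite /j -(mulnn s).
    by move: (M ^ 2)%N (m ^ 4)%N (m ^ (3 * k - 1))%N; clear; nia.
  apply: le_trans (gnp_prob_no_common p01 dX _ _ c0 c1); last 2 first.
  - by rewrite disjoints_subset; apply/subsetP=> x xX; rewrite !inE xX.
  - by rewrite disjoints_subset; apply/subsetP=> x xX; rewrite !inE xX orbT.
  by apply: gnp_prob_mono => // G _ [].
rewrite -!expRD ler_expR !addrA -!natrD lerBlDr addrC lerBrDr -natrD ler_nat /b /j.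
have : (m ^ 2 <= m ^ 4)%N by rewrite leq_pexp2l.
have : (m ^ 1 <= m ^ 4)%N by rewrite leq_pexp2l.
have : (4 * m ^ 2 <= m ^ 4)%N.
  have -> : (m ^ 4 = m ^ 2 * m ^ 2)%N by rewrite -expnD.
  rewrite leq_mul2r; apply/orP; right; rewrite -mulnn.
  have : (16 <= m)%N by apply: leq_trans cLm; move: L0 (expn_gt0 2 k.+1) => /=; move: c; clear; nia.
  clear; nia.
have : (0 < m ^ 2)%N by rewrite expn_gt0 m0.
rewrite expn1; move: (m ^ 2)%N (m ^ 4)%N => A B A0 AB mB _.
have : (s + s + A * s + m <= 2 * (B * s))%N by move: s1 A0 AB mB; clear; nia.
by move/(leq_mul (leqnn L)); clear; nia.
Qed.

(** As t = mM, missing t^2 edges contributes tm to the exponent, against a cost of 2Lt for the two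
    sets. *)
Lemma gnp_dense_fails : pr dense_fails <= expR (- (L * m)%:R).
Proof.
set t := (m ^ (k.*2 - 1))%N.
have tM : (t = m * M)%N by rewrite /t -expnS; congr (m ^ _)%N; move: k3; clear; lia.
apply: le_trans (_ : expR (L * t)%:R * (expR (L * t)%:R * expR (- (t * m)%:R)) <= _).
  apply: gnp_prob_exists_set => [|X cX]; first by rewrite mulr_ge0 ?expR_ge0.
  apply: gnp_prob_exists_set => [|Z cZ]; first exact: expR_ge0.
  have [dX|dX] := boolP [disjoint X & Z]; last first.
    apply: le_trans (expR_ge0 _); rewrite gnp_probE big1 // => G _.
    by rewrite asboolF ?mul0r // => -[].
  apply: le_trans (_ : pr (fun G => forall z, z \in Z -> z \notin nbrs G X) <= _).
    by apply: gnp_prob_mono => // G _ [].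
  apply: le_trans (gnp_prob_no_edge p01 dX) _; apply: expr_1Bp_le.
  by rewrite cX cZ -/t {2}tM; clear; nia.
rewrite -!expRD ler_expR addrA -natrD lerBlDr addrC lerBrDr -natrD ler_nat.
have : (m ^ 1 <= t)%N by rewrite /t leq_pexp2l //; move: k3; clear; lia.
have : (4 * L <= m)%N by apply: leq_trans cLm; move: L0 (expn_gt0 2 k.+1) => /=; move: c; clear; nia.
by rewrite expn1; move: (t); clear; nia.
Qed.

(** Colours and sizes together give at most n <= e^L cases for each kind of failure. *)
Lemma gnp_expander :
  1 - 3 * expR (L%:R - (L * m)%:R) <= pr (expander (fun x : V => x %% c)%N k m).
Proof.
rewrite gnp_probC lerD2l lerN2.
apply: le_trans (_ : pr single_fails + (pr joint_fails + pr dense_fails) <= _).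
  apply: le_trans (le_trans _ (gnp_probU p01 _ _)) (lerD (lexx _) (gnp_probU p01 _ _)).
  apply: gnp_prob_mono => // G Gc nG; apply: contrapT => no; apply: nG.
  by apply: expander_or_fails => //; move=> bad; apply: no; [left|right; left|right; right].
have nE : n%:R <= expR L%:R :> R by apply: le_trans (natr_expR_le _); rewrite ler_nat.
have cm : (2 * c <= m)%N by apply: leq_trans cLm; move: L0; move: c; clear; nia.
have E0 := expR_ge0 (- (L * m)%:R : R).
have bnd x y : (x * y <= n)%N -> x%:R * (y%:R * expR (- (L * m)%:R)) <= expR (L%:R - (L * m)%:R) :> R.
  move=> xy; rewrite expRD mulrA -natrM; apply: ler_wpM2r => //.
  by apply: le_trans nE; rewrite ler_nat.
have b1 := le_trans gnp_single_fails (bnd _ _ _).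
have b2 := le_trans gnp_joint_fails (bnd _ _ _).
have b3 : pr dense_fails <= expR (L%:R - (L * m)%:R).
  by apply: le_trans gnp_dense_fails _; rewrite ler_expR lerDr.
have pk e : (e.+1 <= 3 * k)%N -> (m * m ^ e <= n)%N.
  by move=> ek; rewrite -expnS; apply: leq_trans mn; rewrite leq_pexp2l.
have le1 : (c * m ^ k <= n)%N.
  apply: leq_trans (pk k _); last by move: k3; clear; lia.
  by rewrite leq_mul2r; apply/orP; right; apply: leq_trans cm; rewrite leq_pmull.
have le2 : (c * M.+1 <= n)%N.
  apply: leq_trans (pk (k.*2 - 2)%N _); last by move: k3; clear; lia.
  have : (0 < M)%N by rewrite expn_gt0 m0.
  by move: cm; move: M c; clear; nia.
by apply: le_trans (lerD (b1 le1) (lerD (b2 le2) b3)) _; lra.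
Qed.

End GnpExpander.

(** * Asymptotics *)

From mathcomp Require Import all_classical all_reals all_analysis.

Import Order.TTheory GRing.Theory Num.Theory.
Import numFieldNormedType.Exports.

Lemma ex_nat_root d n : 0 < d -> exists r, r ^ d <= n < r.+1 ^ d.
Proof.
move=> d0; have P0 : exists r, r ^ d <= n by exists 0; rewrite exp0n.
have Pn r : r ^ d <= n -> r <= n.
  by case: r => // r; apply: leq_trans; rewrite -{1}(expn1 r.+1) leq_pexp2l.
case: (ex_maxnP P0 Pn) => r rn rmax; exists r; rewrite rn ltnNge.
by apply/negP=> /rmax; rewrite ltnn.
Qed.

Lemma ltn_exp2_mul n r d : 0 < d -> n < r.+1 ^ d -> n < 2 ^ (d * r).
Proof.
move=> d0 /leq_trans; apply; rewrite mulnC expnM leq_exp2r //; exact: ltn_expl.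
Qed.

Local Open Scope classical_set_scope.
Local Open Scope ring_scope.

(** Let a = 2/3 - eps > 0, the other case being clear. From n < (2r)^(6k) and 6ka <= 4k-6, n^a is at
    most (2r)^(4k-6), and r >= 2^(4k) absorbs the power of 2, leaving r^(4k-5) <= r^(4k-4). *)
Lemma powR_scale_le (R : realType) (eps : R) (k n r : nat) :
  (3 <= k)%N -> 1 <= k%:R * eps -> (n < r.+1 ^ (6 * k))%N -> (0 < n)%N -> (2 ^ (4 * k) <= r)%N ->
  ((r ^ 2) ^ (k.*2 - 2))%:R^-1 <= n%:R `^ (- (2 / 3) + eps).
Proof.
move=> k3 keps nr n0 r4k.
have r0 : (0 < r)%N by apply: leq_trans r4k; rewrite expn_gt0.
have n1 : 1 <= n%:R :> R by rewrite ler1n.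
set M := (_ ^ _)%N; have M1 : 1 <= M%:R :> R by rewrite ler1n !expn_gt0 r0.
have [a0|a0] := lerP 0 (- (2 / 3) + eps).
  apply: le_trans (_ : 1 <= _); first by rewrite invf_le1 ?(lt_le_trans _ M1).
  by have := ler_powR n1 a0; rewrite powRr0.
rewrite -[- (2 / 3) + eps]opprK powRN lef_pV2 ?posrE ?powR_gt0 ?ltr0n //; last by rewrite !expn_gt0 r0.
set a := - (- (2 / 3) + eps); have {}a0 : 0 <= a by rewrite oppr_ge0 ltW.
apply: le_trans (_ : ((2 * r) ^ (6 * k))%:R `^ a <= _).
  apply: ge0_ler_powR => //; rewrite ?nnegrE ?ler0n // ler_nat.
  apply: leq_trans (ltnW nr) _; rewrite leq_exp2r; last by move: k3; clear; lia.
  by move: r0; clear; lia.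
rewrite natrX -powR_mulrn ?ler0n // -powRrM.
apply: le_trans (_ : (2 * r)%:R `^ (4 * k - 6)%:R <= _).
  apply: ler_powR; first by rewrite ler1n muln_gt0.
  rewrite natrB ?natrM; last by move: k3; clear; lia.
  rewrite /a; move: keps; lra.
rewrite powR_mulrn ?ler0n // -natrX ler_nat /M expnMn -expnM.
apply: leq_trans (_ : r * r ^ (4 * k - 6) <= _)%N.
  rewrite leq_mul2r; apply/orP; right; apply: leq_trans r4k.
  by rewrite leq_pexp2l // leq_subr.
by rewrite -expnS leq_pexp2l //; move: k3; clear; lia.
Qed.

Theorem theorem1p5 (R : realType) (eps : R) (p : nat -> R)
    (heps : 0 < eps)
    (hp01 : forall n : nat, 0 <= p n <= 1)
    (hp : \forall n \near \oo, n%:R `^ (- (2 / 3) + eps) <= p n) :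
  (fun n : nat => @gnp_prob R n (p n) (@connector_wins 'I_n 2 2)) @ \oo
    --> (1 : R).
Proof.
have [k k3 keps] : exists2 k : nat, (3 <= k)%N & 1 <= k%:R * eps.
  exists (maxn 3 (Num.bound eps^-1)); first exact: leq_maxl.
  rewrite -ler_pdivrMr // mul1r; apply: le_trans (ltW (archi_boundP _)) _.
    by rewrite invr_ge0 ltW.
  by rewrite ler_nat leq_maxr.
apply/cvgrPdist_le => e e0.
(* The summands serve in turn [cLm], [kLm] (both with L = 6kr and m = r^2), [powR_scale_le] and the
   final error bound. *)
pose r0 := (96 * 2 ^ k.+1 * k + 600 * k * k + 2 ^ (4 * k) + Num.bound (3 / e))%N.
near=> n.
have n0 : (0 < n)%N by near: n; exists 1%N.
have [r /andP[rn nr]] : exists r, (r ^ (6 * k) <= n < r.+1 ^ (6 * k))%N.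
  by apply: ex_nat_root; move: k3; clear; lia.
have r0r : (r0 <= r)%N.
  have r0n : (r0 ^ (6 * k) <= n)%N by near: n; exists (r0 ^ (6 * k))%N.
  rewrite -ltnS -(@ltn_exp2r _ _ (6 * k)); last by move: k3; clear; lia.
  exact: leq_ltn_trans nr.
set m := (r ^ 2)%N; set L := (6 * k * r)%N.
have c1 : (96 * 2 ^ k.+1 * k <= r)%N by apply: leq_trans r0r; rewrite /r0 -!addnA leq_addr.
have c2 : (600 * k * k <= r)%N by apply: leq_trans r0r; rewrite /r0; clear; lia.
have c3 : (2 ^ (4 * k) <= r)%N by apply: leq_trans r0r; rewrite /r0; clear; lia.
have c4 : (Num.bound (3 / e) <= r)%N by apply: leq_trans r0r; rewrite /r0; clear; lia.
have L0 : (0 < L)%N by rewrite /L; move: k3 c3 (expn_gt0 2 (4 * k)) => /=; move: (2 ^ _)%N; clear; nia.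
have mn : (m ^ (3 * k) <= n)%N by rewrite /m -expnM mulnA.
have nL : (n < 2 ^ L)%N by apply: ltn_exp2_mul nr; move: k3; clear; lia.
have Mp : (m ^ (k.*2 - 2))%:R^-1 <= p n.
  apply: le_trans (powR_scale_le k3 keps nr n0 c3) _.
  by near: n.
have cLm : (16 * 2 ^ k.+1 * L <= m)%N.
  by rewrite /L /m -mulnn; move: c1; move: (2 ^ _)%N; clear; nia.
have kLm : (100 * k * L <= m)%N by rewrite /L /m -mulnn; move: c2; clear; nia.
have lb := gnp_expander (hp01 n) k3 L0 cLm mn (ltnW nL) Mp.
have win : gnp_prob (p n) (expander (fun x : 'I_n => x %% 2 ^ k.+1)%N k m)
    <= gnp_prob (p n) (@connector_wins 'I_n 2 2).
  apply: gnp_prob_mono => // G _ Gexp.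
  by apply: (expander_wins (Ordinal n0) k3 L0 kLm _ Gexp); rewrite card_ord.
rewrite ger0_norm ?subr_ge0 ?gnp_prob_le1 //.
suff : 3 * expR (L%:R - (L * m)%:R) <= e.
  by move: (le_trans lb win); lra.
have r1 : 0 < 1 + r%:R :> R by rewrite ltr_wpDr.
(* As L >= r and m >= 2, the exponent is at most -r. *)
have er : expR (L%:R - (L * m)%:R) <= (1 + r%:R)^-1 :> R.
  apply: le_trans (_ : expR (- r%:R) <= _).
    rewrite ler_expR lerBlDr addrC lerBrDr -natrD ler_nat.
    have m2 : (2 <= m)%N by move: kLm k3 L0; clear; nia.
    have rL : (r <= L)%N by rewrite /L; move: k3; clear; nia.
    by move: m2 rL; clear; nia.
  by rewrite expRN lef_pV2 ?posrE ?expR_gt0 ?expR_ge1Dx.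
apply: le_trans (ler_wpM2l _ er) _ => //.
rewrite ler_pdivrMr // -ler_pdivrMl // mulrC.
apply: le_trans (ltW (archi_boundP _)) _; first by rewrite divr_ge0 // ltW.
by apply: le_trans (_ : r%:R <= _); rewrite ?ler_nat // lerDr.
Unshelve. all: by end_near.
Qed.
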